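(* Let $D$ be a diagram of a link $L$ in $\mathbb{RP}^3$. The object $CDBN(D)$ is a chain complex (over $\mathbb{Z}_2$), the chain homotopy equivalence class of which is an invariant of $L$.
   Context: Links and diagrams. A link is an oriented link in $\mathbb{RP}^3$. A diagram of a link is a tangle diagram in the disc $D^2$ with antipodal endpoints (on $\partial D^2$) identified. Two diagrams represent the same link if and only if they are related by a finite sequence of classical Reidemeister moves and two additional moves: R4, pushing a cap (an arc with no crossings) across the boundary circle of the disc, and R5, pushing a crossing across the boundary circle. Positive and negative crossings and their $0$- and $1$-resolutions are defined as in $S^3$ (the oriented resolution is the $0$-resolution at a positive crossing and the $1$-resolution at a negative crossing). A smoothing of $D$ is obtained by taking the $0$- or $1$-resolution at every crossing; it is a disjoint union of circles in $\mathbb{RP}^2$. The smoothings form a cube $\{0,1\}^n$; an edge joins two smoothings differing at exactly one crossing, directed from the $0$- to the $1$-resolution, and the two smoothings cobound a pair of pants (merging or splitting circles) or a once-punctured Möbius band (one circle to one circle), together with cylinders. Chain spaces. Let $R=\mathbb{Z}_2$ and $\mathcal{A}=\langle v_+,v_-\rangle_R$, graded by $p(v_\pm)=\pm1$, extended additively over tensor products. Put $A^k=\mathcal{A}^{\otimes k}\oplus\mathcal{A}^{\otimes k}\{-1\}$, where $\{-1\}$ shifts the $p$-grading by $-1$, and $A=A^1$. The two copies carry superscripts $u$ (unshifted) and $\ell$ (shifted): $A=\langle v^u_+,v^u_-,v^\ell_+,v^\ell_-\rangle_R$. To a smoothing with $k$ circles assign $A^k$, tensor factors corresponding to circles. The height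 of a smoothing is its number of $1$-resolutions minus the number $n_-$ of negative crossings of $D$; the chain space in homological degree $i$ is the direct sum of modules assigned to smoothings of height $i$. Differential of $CDBN(D)$. It is a matrix of maps, one for each edge: $m_2$ or $\Delta_2$ for a pair of pants, $\eta_2$ for a once-punctured Möbius band. The maps $m_2:A^2\to A$, $\Delta_2:A\to A^2$ preserve superscripts (suppressed): $m_2(v_{++})=v_+$, $m_2(v_{+-})=m_2(v_{-+})=v_-$, $m_2(v_{--})=v_-$; $\Delta_2(v_+)=v_{+-}+v_{-+}+v_{++}$, $\Delta_2(v_-)=v_{--}$; acting on the factors of circles involved and as the identity on the others. The map $\eta_2:A\to A$ is $\eta_2(v^u_+)=v^\ell_+$, $\eta_2(v^\ell_+)=v^u_+$, $\eta_2(v^u_-)=v^\ell_-$, $\eta_2(v^\ell_-)=v^u_-$; on $A^k$ it exchanges the superscript of the entire string. *)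

(* Defs.v *)
From HB Require Import structures.
From mathcomp Require Import all_boot all_order all_algebra.
From Stdlib Require Import Relations.

Set Implicit Arguments.
Unset Strict Implicit.
Unset Printing Implicit Defensive.

Import GRing.Theory.
Local Open Scope ring_scope.

Record preComplex (K : nzRingType) := PreComplex {
  obj :> int -> lmodType K;
  d : forall i : int, {linear obj i -> obj (i + 1)}
}.

Definition is_complex (K : nzRingType) (C : preComplex K) : Prop :=
  forall (i : int) (x : C i), d C (i + 1) (d C i x) = 0.

Definition is_chain_map (K : nzRingType) (B C : preComplex K)
    (f : forall i : int, {linear B i -> C i}) : Prop :=
  forall (i : int) (x : B i), f (i + 1) (d B i x) = d C i (f i x).

(* The homotopy is indexed by the degree of its target, so that no transport
   along i - 1 + 1 = i is needed; every degree of int is of the form i + 1. *)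
Definition homotopic (K : nzRingType) (B C : preComplex K)
    (f g : forall i : int, B i -> C i) : Prop :=
  exists h : forall i : int, {linear B (i + 1) -> C i},
    forall (i : int) (x : B (i + 1)),
      f (i + 1) x - g (i + 1) x = d C i (h i x) + h (i + 1) (d B (i + 1) x).

Definition homotopy_equivalent (K : nzRingType) (B C : preComplex K) : Prop :=
  exists (f : forall i : int, {linear B i -> C i})
         (g : forall i : int, {linear C i -> B i}),
    [/\ is_chain_map f, is_chain_map g,
        @homotopic K B B (fun i x => g i (f i x)) (fun _ x => x)
      & @homotopic K C C (fun i x => f i (g i x)) (fun _ x => x)].

Local Close Scope ring_scope.

(* Oriented tangle diagrams in the disc, in Morse position.

   The disc is drawn as a rectangle.  A generic horizontal line meets the
   diagram in finitely many points, recorded from left to right by the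
   direction of the strand (true = upwards).  Reading upwards, a diagram is a
   word of elementary tangles (i, g): the piece g with i strands to its left.
     Cup o   : a local minimum; its left end is directed upwards iff o
     Cap     : a local maximum
     Cross b : a crossing; b iff the strand joining bottom left to top right
               is the overstrand *)

Inductive piece := Cup of bool | Cap | Cross of bool.

Definition slice : Type := nat * piece.

Definition nin (g : piece) : nat := if g is Cup _ then 0 else 2.
Definition nout (g : piece) : nat := if g is Cap then 0 else 2.

Definition act (e : seq bool) (a : slice) : seq bool :=
  let: (i, g) := a in
  take i e ++
  match g with
  | Cup o => [:: o; ~~ o]
  | Cap => [::]
  | Cross _ => [:: nth false e i.+1; nth false e i]
  end ++ drop (i + nin g) e.

Definition admissible (e : seq bool) (a : slice) : bool :=
  let: (i, g) := a in
  (i + nin g <= size e) &&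
  (if g is Cap then nth false e i != nth false e i.+1 else true).

Fixpoint valid (e : seq bool) (w : seq slice) : bool :=
  if w is a :: w' then admissible e a && valid (act e a) w' else true.

(* The antipodal map sends the j-th top endpoint from the left to the j-th
   bottom endpoint from the right; a strand leaving the disc upwards comes back
   upwards, whence the rev in the closing condition. *)
Record diagram := Diagram {
  bot : seq bool;
  word : seq slice;
  diagramP : valid bot word && (foldl act bot word == rev bot)
}.

Definition shift (w : seq slice) : seq slice := [seq (a.1.+1, a.2) | a <- w].

(* Moves inside the disc.  The first five generate planar isotopy of diagrams
   in Morse position: exchange of the heights of two distant pieces, the two
   zigzags, and a maximum or minimum passing through a crossing point (the
   crossing turns by a quarter, which exchanges the two values of Cross). *)
Variant local_move : seq slice -> seq slice -> Prop :=
| Exchange (i k : nat) (g1 g2 : piece) :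
    local_move [:: (i, g1); ((i + nout g1 + k), g2)]
               [:: ((i + nin g1 + k), g2); (i, g1)]
| ZigzagL (i : nat) (o : bool) : local_move [:: (i, Cup o); (i.+1, Cap)] [::]
| ZigzagR (i : nat) (o : bool) : local_move [:: (i.+1, Cup o); (i, Cap)] [::]
| TurnCap (i : nat) (b : bool) :
    local_move [:: (i.+1, Cross b); (i, Cap)] [:: (i, Cross (~~ b)); (i.+1, Cap)]
| TurnCup (i : nat) (o b : bool) :
    local_move [:: (i, Cup o); (i.+1, Cross b)]
               [:: (i.+1, Cup o); (i, Cross (~~ b))]
| R1r (i : nat) (o b : bool) :
    local_move [:: (i.+1, Cup o); (i, Cross b); (i.+1, Cap)] [::]
| R1l (i : nat) (o b : bool) :
    local_move [:: (i, Cup o); (i.+1, Cross b); (i, Cap)] [::]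
| R2 (i : nat) (b : bool) :
    local_move [:: (i, Cross b); (i, Cross (~~ b))] [::]
(* a, b, c say whether strand 1 is over 2, 1 over 3, 2 over 3; the side
   condition excludes the two cyclic configurations. *)
| R3 (i : nat) (a b c : bool) : (a == b) || (b == c) ->
    local_move [:: (i, Cross a); (i.+1, Cross b); (i, Cross c)]
               [:: (i.+1, Cross c); (i, Cross b); (i.+1, Cross a)].

(* Crossing the boundary circle reflects the disc left to right and turns it
   upside down in the fibre direction, so Cross b stays Cross b. *)
Definition reflect_piece (g : piece) : piece :=
  if g is Cup o then Cup (~~ o) else g.

Variant move : diagram -> diagram -> Prop :=
| InDisc (D D' : diagram) (w1 u v w2 : seq slice) :
    local_move u v ->
    bot D' = bot D -> word D = w1 ++ u ++ w2 -> word D' = w1 ++ v ++ w2 ->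
    move D D'
(* Rotation of the disc: the bottom left endpoint slides up the left side to
   become the top left one, its antipode slides down the right side. *)
| Rotate (D D' : diagram) (o : bool) (e : seq bool) :
    bot D = o :: e -> bot D' = rcons e (~~ o) ->
    word D' = (0, Cup (~~ o)) :: shift (word D) ++ [:: ((size e).+1, Cap)] ->
    move D D'
(* R4 when g is a cup or a cap, R5 when g is a crossing. *)
| AcrossBoundary (D D' : diagram) (w : seq slice) (i : nat) (g : piece) :
    word D = w ++ [:: (i, g)] ->
    bot D' = rev (foldl act (bot D) w) ->
    word D' = ((size (bot D) - nout g - i), reflect_piece g) :: w ->
    move D D'.

Definition same_link : diagram -> diagram -> Prop :=
  clos_refl_sym_trans diagram move.

Definition level (D : diagram) (t : nat) : seq bool :=
  foldl act (bot D) (take t (word D)).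

Definition pos (D : diagram) (t : nat) : nat := (nth (0, Cap) (word D) t).1.
Definition pc (D : diagram) (t : nat) : piece := (nth (0, Cap) (word D) t).2.

Definition is_cross (g : piece) : bool := if g is Cross _ then true else false.

Definition crossing (D : diagram) : finType :=
  {t : 'I_(size (word D)) | is_cross (pc D t)}.

Definition ht (D : diagram) (c : crossing D) : nat := val c.

Definition sw_over (D : diagram) (c : crossing D) : bool :=
  if pc D (ht c) is Cross b then b else false.

Definition positive (D : diagram) (c : crossing D) : bool :=
  let e := level D (ht c) in
  let i := pos D (ht c) in
  sw_over c == (nth false e i == nth false e i.+1).

(* s c = false is the 0-resolution and s c = true the 1-resolution at c. *)
Definition smoothing (D : diagram) : finType := {ffun crossing D -> bool}.

(* The resolution joining left to left and right to right is the 0-resolution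
   iff the strand from bottom left to top right is over. *)
Definition vertical (D : diagram) (s : smoothing D) (c : crossing D) : bool :=
  sw_over c != s c.

(* Where the diagram meets the horizontal lines separating its pieces. *)
Definition point (D : diagram) : finType :=
  {t : 'I_(size (word D)).+1 & 'I_(size (level D t))}.

Definition at_ (D : diagram) (p : point D) (t j : nat) : bool :=
  (tag p == t :> nat) && (tagged p == j :> nat).

(* p and q are joined by a piece of strand outside the crossings. *)
Definition strand (D : diagram) (p q : point D) : bool :=
  [exists t : 'I_(size (word D)),
    let i := pos D t in let g := pc D t in
    [|| [&& tag p == t :> nat, tag q == t.+1 :> nat
          & ((tagged p < i) && (tagged q == tagged p :> nat))
            || ((i + nin g <= tagged p)
                && (tagged q + nin g == tagged p + nout g))]
      , (if g is Cup _ then at_ p t.+1 i && at_ q t.+1 i.+1 else false)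
      | (if g is Cap then at_ p t i && at_ q t i.+1 else false)]].

Definition antipodal (D : diagram) (p q : point D) : bool :=
  [&& tag p == size (word D) :> nat, tag q == 0 :> nat
    & (tagged p + tagged q).+1 == size (bot D)].

Definition resolved (D : diagram) (s : smoothing D) (p q : point D) : bool :=
  [exists c : crossing D,
    let t := ht c in let i := pos D t in
    if vertical s c then
      (at_ p t i && at_ q t.+1 i) || (at_ p t i.+1 && at_ q t.+1 i.+1)
    else (at_ p t i && at_ q t i.+1) || (at_ p t.+1 i && at_ q t.+1 i.+1)].

Definition adjacent (D : diagram) (s : smoothing D) : rel (point D) :=
  fun p q => let r p q := [|| strand p q, antipodal p q | resolved s p q] in
  r p q || r q p.

Definition circle (D : diagram) (s : smoothing D) (p : point D) :
    {set point D} :=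
  [set q | connect (adjacent s) p q].

Definition circles (D : diagram) (s : smoothing D) : {set {set point D}} :=
  [set circle s p | p : point D].

Definition n_minus (D : diagram) : nat := #|[set c : crossing D | ~~ positive c]|.

Definition height (D : diagram) (s : smoothing D) : int :=
  (#|[set c | s c]|%:Z - (n_minus D)%:Z)%R.

(* A basis vector of calA is a boolean, true for v_+ and false
   for v_-.  A basis vector of A^k at a smoothing is a labelling of the points
   of the diagram, constant along circles (i.e. a labelling of the k circles),
   together with a superscript, true for u and false for l.  The grading p
   enters neither the differential nor homotopy equivalence. *)

Definition enhanced (D : diagram) : finType :=
  (smoothing D * {ffun point D -> bool} * bool)%type.

Definition sm (D : diagram) (x : enhanced D) : smoothing D := x.1.1.
Definition lab (D : diagram) (x : enhanced D) : point D -> bool := x.1.2.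
Definition sup (D : diagram) (x : enhanced D) : bool := x.2.

Definition constant_on_circles (D : diagram) (x : enhanced D) : bool :=
  [forall p, forall q in circle (sm x) p, lab x q == lab x p].

Definition generator (D : diagram) (i : int) : finType :=
  {x : enhanced D | constant_on_circles x && (height (sm x) == i)}.

Definition chain (D : diagram) (i : int) : lmodType 'F_2 :=
  {ffun generator D i -> ('F_2)^o}.

Definition m2 (a b : bool) : bool := a && b.

(* The basis vectors occurring in Delta_2 (v_a), all with coefficient 1. *)
Definition Delta2 (a : bool) : seq (bool * bool) :=
  if a then [:: (true, false); (false, true); (true, true)]
  else [:: (false, false)].

Definition eta2 (u : bool) : bool := ~~ u.

Definition edge (D : diagram) (c : crossing D) (s s' : smoothing D) : bool :=
  [&& ~~ s c, s' c & [forall c', (c' != c) ==> (s' c' == s c')]].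

Definition corner (D : diagram) (c : crossing D) (p : point D) : bool :=
  let t := ht c in let i := pos D t in
  [|| at_ p t i, at_ p t i.+1, at_ p t.+1 i | at_ p t.+1 i.+1].

Definition involved (D : diagram) (c : crossing D) (s : smoothing D)
    (p : point D) : bool :=
  [exists q in circle s p, corner c q].

Definition merges (D : diagram) (c : crossing D) (x y : enhanced D) : bool :=
  (sup y == sup x) &&
  [forall p, forall q, [&& corner c p, corner c q & q \notin circle (sm x) p]
    ==> (lab y p == m2 (lab x p) (lab x q))].

Definition splits (D : diagram) (c : crossing D) (x y : enhanced D) : bool :=
  (sup y == sup x) &&
  [forall p, forall q, [&& corner c p, corner c q & q \notin circle (sm y) p]
    ==> ((lab y p, lab y q) \in Delta2 (lab x p))].

Definition switches (D : diagram) (c : crossing D) (x y : enhanced D) : bool :=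
  (sup y == eta2 (sup x)) && [forall p, corner c p ==> (lab y p == lab x p)].

(* Whether the basis vector y occurs in the image of the basis vector x. *)
Definition incident (D : diagram) (x y : enhanced D) : bool :=
  [exists c : crossing D,
    [&& edge c (sm x) (sm y),
        [forall p, ~~ involved c (sm x) p ==> (lab y p == lab x p)]
      & if (#|circles (sm y)| < #|circles (sm x)|) then merges c x y
        else if (#|circles (sm x)| < #|circles (sm y)|) then splits c x y
        else switches c x y]].

Local Open Scope ring_scope.

Definition diff (D : diagram) (i : int) (x : chain D i) : chain D (i + 1) :=
  [ffun y => \sum_(g : generator D i) (incident (val g) (val y))%:R * x g].

Lemma diff_is_linear (D : diagram) (i : int) : linear (@diff D i).
Proof.
move=> a x y; apply/ffunP => z; rewrite !ffunE /= scaler_sumr -big_split /=.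
apply: eq_bigr => g _; rewrite !ffunE mulrDr; congr (_ + _).
by rewrite [LHS]mulrCA.
Qed.

HB.instance Definition _ (D : diagram) (i : int) :=
  GRing.isLinear.Build 'F_2 (chain D i) (chain D (i + 1)) _ (@diff D i)
    (@diff_is_linear D i).

Definition CDBN (D : diagram) : preComplex 'F_2 :=
  PreComplex (fun i : int => (@diff D i : {linear chain D i -> chain D (i + 1)})).

(* Main.v *)
From HB Require Import structures.
Require Import Defs.
From mathcomp Require Import all_boot all_order all_algebra.
From mathcomp Require Import zify ring.
From Stdlib Require Import Btauto.

Set Implicit Arguments.
Unset Strict Implicit.
Unset Printing Implicit Defensive.

Import GRing.Theory.

(** The Frobenius algebra behind [m2] and [Delta2] is F_2[X]/(X^2 - X), with
    X = v_-, and it splits. The idempotents a = v_+ + v_- and b = v_- satisfy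
    aa = a, bb = b, ab = 0, Delta_2(a) = a (x) a and Delta_2(b) = b (x) b. Pass to
    the basis of smoothings with circles coloured by a and b: the differential
    turns a 0-resolution into a 1-resolution wherever the four corners of the
    crossing have the same colour, keeps all colours, and vanishes elsewhere.
    The superscript is exchanged by the one-to-one bifurcations only. All other
    bifurcations change the number of circles by one, so adding the parity of
    the number of circles plus the number of 1-resolutions to the superscript
    makes it constant. This change of basis is [incident_zeta]; it rests on
    [bifurcation], that is, on the fact that the rest of the diagram pairs up
    the corners of a crossing ([corner_parity]).

    The complex is thus a direct sum over colourings. The summand of a colouring
    is a cube with one direction for each crossing with corners of one colour;
    its faces commute ([cube_cube]), and it is contractible as soon as there is
    one direction ([contraction_homotopy]). There remain, with zero
    differential, the proper colourings: those whose two arcs at each crossing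
    have different colours. Over a field, two such complexes are
    homotopy equivalent when their proper colourings are equally numerous in
    every degree ([CDBN_homotopy_equivalent]).

    It remains to count proper colourings. Read upwards, a crossing turns the
    colours x, y into ~y, ~x, which forces its resolution. (The sum of the
    colour and the parity of the position is a local orientation of the strands,
    as in Lee's theory for links in the 3-sphere; colours have the advantage that
    they agree at antipodal points.) The number of proper colourings, with a
    weight q for each 1-resolution, is hence the trace of a product of transfer
    operators, one for each piece of the diagram ([sum_proper]). A move inside
    the disc multiplies such a product by a power of q, the same as that by
    which the number of negative crossings changes ([local_move_invariant]); it
    is here that the normalization of the degree enters. Pushing a piece across
    the boundary circle permutes the factors cyclically
    ([across_boundary_agree]), and so does, in essence, a rotation
    ([rotate_agree]). *)

(** * Connectivity of finite graphs *)

Lemma connect_invariant (T : finType) (R : eqType) (r : rel T) (f : T -> R) :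
  (forall p q, r p q -> f p = f q) -> forall p q, connect r p q -> f p = f q.
Proof.
move=> rf p q /connectP[s]; elim: s p => [|x s IH] p /=; first by move=> _ ->.
by case/andP=> /rf -> /IH; apply.
Qed.

Section Gluing.

Variables (T : finType) (r : rel T).
Hypothesis r_sym : symmetric r.

(** Two edges at once, because a resolution adds two arcs. *)
Definition glue (a b a' b' : T) : rel T := fun p q =>
  [|| r p q, (p == a) && (q == b), (p == b) && (q == a),
      (p == a') && (q == b') | (p == b') && (q == a')].

Let C := connect r.

Let C_sym : symmetric C.
Proof. exact: sym_connect_sym. Qed.

Lemma glue_sym a b a' b' : symmetric (glue a b a' b').
Proof.
move=> p q; rewrite /glue r_sym; congr (_ || _).
by do 4 case: eqP => ? //=; do ?case: eqP => ? //=; rewrite ?orbT ?orbF ?andbF //=;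
  do ?case: eqP => ? //=.
Qed.

Lemma connect_glue_connected a b a' b' :
  C a b -> C a' b' -> connect (glue a b a' b') =2 C.
Proof.
move=> Cab Cab' p q; apply/idP/idP; last first.
  by apply: connect_sub => x y rxy; apply: connect1; rewrite /glue rxy.
apply: connect_sub => x y; rewrite /glue.
case/or4P=> [/connect1 //|||/orP[]] /andP[/eqP-> /eqP->] //.
- by rewrite -/(C _ _) C_sym.
- by rewrite -/(C _ _) C_sym.
Qed.

Lemma connect_glue_joined a b a' b' :
    C a a' -> C b b' ->
  forall p q, connect (glue a b a' b') p q =
    C p q || ((C a p || C b p) && (C a q || C b q)).
Proof.
move=> Caa Cbb p q; set U := fun p => C a p || C b p.
have CE x y : C x y -> C x =1 C y by move=> Cxy z; apply: same_connect => //; exact: C_sym.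
have UC x y : C x y -> U x = U y.
  by move=> Cxy; rewrite /U ![C _ x]C_sym ![C _ y]C_sym !(CE _ _ Cxy).
apply/idP/idP.
  pose f x := C p x || U p && U x.
  move=> gpq; suff: f p = f q by rewrite /f {1}/C connect0 /= => <-.
  apply: connect_invariant gpq => x y.
  have Ua : U a by rewrite /U /C connect0.
  have Ub : U b by rewrite /U /C connect0 orbT.
  have Ua' : U a' by rewrite -(UC _ _ Caa).
  have Ub' : U b' by rewrite -(UC _ _ Cbb).
  have fU z : U z -> f z = U p.
    by move=> Uz; rewrite /f Uz andbT; case: (boolP (C p z)) => // /UC ->.
  rewrite /glue => /or4P[/connect1 rxy|||/orP[]]; last 4 first.
  - by case/andP=> /eqP-> /eqP->; rewrite !fU.
  - by case/andP=> /eqP-> /eqP->; rewrite !fU.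
  - by case/andP=> /eqP-> /eqP->; rewrite !fU.
  - by case/andP=> /eqP-> /eqP->; rewrite !fU.
  by rewrite /f ![C p _]C_sym (CE _ _ rxy) (UC _ _ rxy).
have Csub x y : C x y -> connect (glue a b a' b') x y.
  by apply: connect_sub => {}x {}y rxy; apply: connect1; rewrite /glue rxy.
have gs : connect_sym (glue a b a' b') := sym_connect_sym (@glue_sym a b a' b').
have ga x : U x -> connect (glue a b a' b') a x.
  case/orP => [/Csub //|/Csub]; apply: connect_trans.
  by apply: connect1; rewrite /glue !eqxx /= orbT.
case/orP => [/Csub //|/andP[/ga ap /ga aq]].
by apply: connect_trans aq; rewrite gs.
Qed.

End Gluing.

(** [K'] arises from the equivalence [K] by uniting the distinct classes of
    [a] and [b]. *)
Definition merged (T : finType) (K K' : rel T) (a b : T) : Prop :=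
  ~~ K a b /\ forall p q, K' p q = K p q || ((K a p || K b p) && (K a q || K b q)).

(** The two resolutions of a crossing glue its corners along [ab], [cd] and
    along [ac], [bd]. If the rest of the diagram pairs the corners up in one of
    these two ways, the corresponding resolution glues nothing new and the other
    one unites at most two classes. The third pairing is the one-to-one
    bifurcation: either resolution unites the same two classes. *)
Lemma resolution_trichotomy (T : finType) (r : rel T) (a b c d : T) :
    symmetric r ->
    [\/ connect r a b && connect r c d, connect r a c && connect r b d
      | connect r a d && connect r b c] ->
  let K := connect (glue r a b c d) in let K' := connect (glue r a c b d) in
  [\/ K =2 K', merged K K' a c /\ K a b && K c d
    | merged K' K a b /\ K' a c && K' b d].
Proof.
move=> rs H K K'; have Cs : symmetric (connect r) by exact: sym_connect_sym.
case: H => /andP[H1 H2].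
- have KE : K =2 connect r by exact: connect_glue_connected.
  have K'E := connect_glue_joined rs H1 H2; rewrite -/K' in K'E.
  have [Cac|nCac] := boolP (connect r a c).
    apply: Or31 => p q; rewrite KE K'E.
    have [//|nCpq] := boolP (connect r p q); apply/esym/negbTE; apply: contra nCpq.
    have Cc z : connect r c z = connect r a z by apply/esym/same_connect.
    rewrite !Cc !orbb => /andP[Cap Caq].
    by apply: connect_trans Caq; rewrite Cs.
  apply: Or32; split; last by rewrite !KE H1.
  by split=> [|p q]; rewrite !KE // K'E.
- have K'E : K' =2 connect r by exact: connect_glue_connected.
  have KE := connect_glue_joined rs H1 H2; rewrite -/K in KE.
  have [Cab|nCab] := boolP (connect r a b).
    apply: Or31 => p q; rewrite K'E KE.
    have [//|nCpq] := boolP (connect r p q); apply/negbTE; apply: contra nCpq.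
    have Cc z : connect r b z = connect r a z by apply/esym/same_connect.
    rewrite !Cc !orbb => /andP[Cap Caq].
    by apply: connect_trans Caq; rewrite Cs.
  apply: Or33; split; last by rewrite !K'E H1.
  by split=> [|p q]; rewrite !K'E // KE.
- apply: Or31 => p q.
  have E1 : K p q = connect (glue r a b d c) p q.
    apply: eq_connect => x y; rewrite /glue; congr [|| _, _, _ | _]; exact: orbC.
  have E2 : K' p q = connect (glue r a c d b) p q.
    apply: eq_connect => x y; rewrite /glue; congr [|| _, _, _ | _]; exact: orbC.
  rewrite E1 E2 connect_glue_joined //.
  rewrite [RHS]connect_glue_joined //; last by rewrite Cs.
  have Cc z : connect r b z = connect r c z by apply: same_connect.
  by rewrite !Cc.
Qed.

Lemma card_merged (T : finType) (K K' : rel T) (a b : T) :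
    equivalence_rel K -> merged K K' a b ->
  #|[set [set q | K p q] | p : T]| = #|[set [set q | K' p q] | p : T]|.+1.
Proof.
move=> eqK [nKab K'E].
have Kr p : K p p by case: (eqK p p p).
have KE p q : K p q -> K p =1 K q.
  by move=> Kpq z; case: (eqK p q z) => _; apply.
have Ks : symmetric K.
  by move=> p q; apply/idP/idP => H; rewrite -(KE _ _ H) Kr.
pose cl p := [set q | K p q]; pose cl' p := [set q | K' p q].
have clE p q : (cl p == cl q) = K p q.
  apply/eqP/idP => [/setP/(_ q)|/KE E]; first by rewrite !inE Kr.
  by apply/setP => z; rewrite !inE E.
pose W := cl a :|: cl b.
have inW p : (p \in W) = K a p || K b p by rewrite !inE.
have cl'E p : cl' p = if K a p || K b p then W else cl p.
  apply/setP => q; rewrite inE K'E; case: ifP => Up; last by rewrite inE orbF.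
  rewrite inW /=; case Kpq: (K p q) => //=; apply/esym.
  by move: Up; rewrite ![K _ p]Ks ![K _ q]Ks !(KE _ _ Kpq).
rewrite -/cl -/cl'.
have Wn p : cl p != W.
  apply/eqP => /setP E; have := E a; have := E b.
  by rewrite !inE !Kr orbT => Kpb Kpa; rewrite -(KE p) ?Kpb // in nKab.
have imE : [set cl' p | p : T] = W |: ([set cl p | p : T] :\ cl a :\ cl b).
  apply/setP => X; apply/imsetP/idP => [[p _ ->]|].
    rewrite cl'E; case: ifP => [_|/norP[nKa nKb]]; first by rewrite setU11.
    by rewrite !inE !clE ![K p _]Ks (negbTE nKa) (negbTE nKb) imset_f ?orbT.
  rewrite !inE => /orP[/eqP->|/and3P[nb na /imsetP[p _ E]]].
    by exists a => //; rewrite cl'E Kr.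
  exists p => //; rewrite cl'E E.
  by move: na nb; rewrite E !clE ![K p _]Ks => /negbTE-> /negbTE->.
rewrite imE cardsU1 (cardsD1 (cl a) [set cl p | p : T]) imset_f //.
rewrite (cardsD1 (cl b) ([set cl p | p : T] :\ cl a)).
rewrite in_setD1 clE Ks (negbTE nKab) imset_f //= add1n.
suff -> : W \notin [set cl p | p : T] :\ cl a :\ cl b by [].
apply/negP; rewrite !inE => /and3P[_ _ /imsetP[p _ E]].
by move: (Wn p); rewrite E eqxx.
Qed.

(** * Colourings of a diagram, read level by level *)

Lemma valid_admissible e w t : valid e w -> t < size w ->
  admissible (foldl act e (take t w)) (nth (0, Cap) w t).
Proof.
elim: w e t => [|a w IH] e [|t] //= /andP[adm val] lt_t; first exact: adm.
by apply: IH.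
Qed.

(** An equation without subtraction, as pieces can both add and remove points. *)
Lemma size_act e i g : i + nin g <= size e ->
  size (act e (i, g)) + nin g = size e + nout g.
Proof.
by case: g => [o||b] /= H; rewrite !size_cat /= size_takel ?size_drop; lia.
Qed.

Section Levels.

Variable D : diagram.
Implicit Types (f : point D -> bool) (p q : point D) (t j : nat).

Lemma level_succ t : t < size (word D) ->
  level D t.+1 = act (level D t) (pos D t, pc D t).
Proof.
move=> lt_t; rewrite /level (take_nth (0, Cap)) // -cats1 foldl_cat /=.
by rewrite /pos /pc; case: nth.
Qed.

Lemma level_last : level D (size (word D)) = rev (bot D).
Proof. by rewrite /level take_size; case/andP: (diagramP D) => _ /eqP. Qed.

Lemma level_admissible t : t < size (word D) ->
  admissible (level D t) (pos D t, pc D t).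
Proof.
case/andP: (diagramP D) => val _ /(valid_admissible val).
by rewrite /pos /pc -/(level D t); case: nth.
Qed.

Lemma pos_bound t : t < size (word D) ->
  pos D t + nin (pc D t) <= size (level D t).
Proof. by move/level_admissible => /andP[]. Qed.

Lemma size_level_succ t : t < size (word D) ->
  size (level D t.+1) + nin (pc D t) = size (level D t) + nout (pc D t).
Proof. by move=> lt_t; rewrite level_succ // size_act // pos_bound. Qed.

Lemma point_at t j : t <= size (word D) -> j < size (level D t) ->
  {p : point D | at_ p t j}.
Proof.
rewrite -ltnS => lt_t lt_j.
exists (Tagged (fun t : 'I_(size (word D)).+1 => 'I_(size (level D t)))
  (Ordinal lt_j : 'I_(size (level D (Ordinal lt_t))))).
by rewrite /at_ /= !eqxx.
Qed.

Lemma at_inj p q t j : at_ p t j -> at_ q t j -> p = q.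
Proof.
case: p q => [t1 j1] [t2 j2] /andP[/= /eqP E1 /eqP F1] /andP[/= /eqP E2 /eqP F2].
have E : t1 = t2 by apply: val_inj; rewrite /= E1.
by case: t2 / E j2 E2 F2 => j2 _ F2; congr existT; apply: val_inj; rewrite /= F1.
Qed.

Lemma at_self p : at_ p (tag p) (tagged p).
Proof. by rewrite /at_ !eqxx. Qed.

Lemma tag_bound p : tag p <= size (word D).
Proof. by rewrite -ltnS. Qed.

(** Levels are read as plain sequences: this removes the dependency of the type
    of a point on its level, and lets levels be computed as in [act]. *)
Definition colours f t : seq bool :=
  mkseq (fun j => if [pick p | at_ p t j] is Some p then f p else false)
        (size (level D t)).

Lemma size_colours f t : size (colours f t) = size (level D t).
Proof. exact: size_mkseq. Qed.

Lemma nth_colours f p t j : at_ p t j -> nth false (colours f t) j = f p.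
Proof.
move=> pt; rewrite nth_mkseq; last first.
  by case/andP: (pt) => /eqP <- /eqP <-.
by case: pickP => [q qt|/(_ p)]; [rewrite (at_inj qt pt)|rewrite pt].
Qed.

Lemma nth_colours_self f p : nth false (colours f (tag p)) (tagged p) = f p.
Proof. exact/nth_colours/at_self. Qed.

Lemma colours_inj f f' :
  (forall t, t <= size (word D) -> colours f t = colours f' t) -> f =1 f'.
Proof. by move=> E p; rewrite -!nth_colours_self E // tag_bound. Qed.

(** How the colours below and above a piece are related by the strands that
    do not pass through a crossing. *)
Definition flows (i : nat) (g : piece) (A B : seq bool) : bool :=
  [&& take i A == take i B, drop (i + nin g) A == drop (i + nout g) B,
      (if g is Cup _ then nth false B i == nth false B i.+1 else true)
    & (if g is Cap then nth false A i == nth false A i.+1 else true)].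

Lemma strand_flows f :
  (forall p q, strand p q -> f p = f q) <->
  (forall t, t < size (word D) ->
     flows (pos D t) (pc D t) (colours f t) (colours f t.+1)).
Proof.
split=> [inv t lt_t | fl p q].
  have bd := pos_bound lt_t; have sz := size_level_succ lt_t.
  pose ot := Ordinal lt_t.
  have eqj j j' : j < size (level D t) -> j' < size (level D t.+1) ->
      ((j < pos D t) && (j' == j)) ||
      ((pos D t + nin (pc D t) <= j) && (j' + nin (pc D t) == j + nout (pc D t))) ->
      nth false (colours f t) j = nth false (colours f t.+1) j'.
    move=> lj lj' H.
    have [p atp] := point_at (ltnW lt_t) lj; have [q atq] := point_at lt_t lj'.
    rewrite (nth_colours f atp) (nth_colours f atq); apply: inv.
    case/andP: atp atq => E1 /eqP E2 /andP[E3 /eqP E4].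
    by apply/existsP; exists ot; rewrite /= E1 E2 E3 E4 H.
  apply/and4P; split.
  - apply/eqP/(@eq_from_nth _ false); rewrite ?size_take_min !size_colours; first lia.
    move=> j lj; rewrite !nth_take; [|lia|lia].
    by apply: eqj; [lia|lia|]; rewrite eqxx andbT (_ : j < pos D t) //; lia.
  - apply/eqP/(@eq_from_nth _ false); rewrite ?size_drop !size_colours; first lia.
    move=> j lj; rewrite !nth_drop; apply: eqj; [lia|lia|].
    by apply/orP; right; apply/andP; split; [lia|apply/eqP; lia].
  - case E: (pc D t) => [o||b] //; rewrite E /= in bd sz.
    have [|p atp] := @point_at t.+1 (pos D t) lt_t; first lia.
    have [|q atq] := @point_at t.+1 (pos D t).+1 lt_t; first lia.
    rewrite (nth_colours f atp) (nth_colours f atq); apply/eqP/inv.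
    by apply/existsP; exists ot; rewrite /= E /= atp atq !orbT.
  - case E: (pc D t) => [o||b] //; rewrite E /= in bd sz.
    have [|p atp] := @point_at t (pos D t) (ltnW lt_t); first lia.
    have [|q atq] := @point_at t (pos D t).+1 (ltnW lt_t); first lia.
    rewrite (nth_colours f atp) (nth_colours f atq); apply/eqP/inv.
    by apply/existsP; exists ot; rewrite /= E /= atp atq !orbT.
case/existsP => t; have := fl t (ltn_ord t).
have bd := pos_bound (ltn_ord t); have sz := size_level_succ (ltn_ord t).
case/and4P => /eqP tk /eqP dr cu ca /or3P[].
- case/and3P => E1 E2.
  rewrite -(@nth_colours f p t (tagged p)) /at_ ?E1 ?eqxx //.
  rewrite -(@nth_colours f q t.+1 (tagged q)) /at_ ?E2 ?eqxx //.
  case/orP => [/andP[lt /eqP ->]|/andP[le /eqP E]].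
    by rewrite -(nth_take false lt) tk nth_take.
  have -> : tagged p = pos D t + nin (pc D t) + (tagged p - (pos D t + nin (pc D t))) :> nat by lia.
  rewrite -nth_drop dr nth_drop; congr nth; lia.
- case: (pc D t) cu => [o||b] // /eqP cu /andP[atp atq].
  by rewrite -(nth_colours f atp) -(nth_colours f atq).
- case: (pc D t) ca => [o||b] // /eqP ca /andP[atp atq].
  by rewrite -(nth_colours f atp) -(nth_colours f atq).
Qed.

Lemma antipodal_colours f :
  (forall p q, antipodal p q -> f p = f q) <->
  colours f (size (word D)) = rev (colours f 0).
Proof.
have szl : size (level D (size (word D))) = size (bot D).
  by rewrite level_last size_rev.
have sz0 : size (level D 0) = size (bot D) by rewrite /level take0.
split=> [inv | E p q /and3P[E1 E2 /eqP E3]].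
  apply: (@eq_from_nth _ false); first by rewrite size_rev !size_colours szl sz0.
  rewrite size_colours szl => j lj.
  rewrite nth_rev size_colours sz0 //.
  have [|p atp] := @point_at (size (word D)) j (leqnn _); first by rewrite szl.
  have [|q atq] := @point_at 0 (size (bot D) - j.+1) (leq0n _); first by rewrite sz0; lia.
  rewrite (nth_colours f atp) (nth_colours f atq); apply: inv.
  move: atp atq => /andP[E1 /eqP E2] /andP[E3 /eqP E4].
  by rewrite /antipodal E1 E2 E3 E4 /=; apply/eqP; lia.
rewrite -(@nth_colours f p (size (word D)) (tagged p)) /at_ ?E1 ?eqxx //.
rewrite -(@nth_colours f q 0 (tagged q)) /at_ ?E2 ?eqxx // E.
rewrite nth_rev size_colours sz0; last lia.
by congr nth; lia.
Qed.

(** * Crossings and their corners *)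

Lemma ht_lt (c : crossing D) : ht c < size (word D).
Proof. exact: ltn_ord. Qed.

Lemma pc_ht (c : crossing D) : pc D (ht c) = Cross (sw_over c).
Proof.
rewrite /sw_over /ht; move: (valP c) => /=.
by case: (pc D (val (val c))).
Qed.

Lemma ht_inj : injective (@ht D).
Proof. by move=> c c' /val_inj/val_inj. Qed.

Lemma crossing_at t b : t < size (word D) -> pc D t = Cross b ->
  exists2 c : crossing D, ht c = t & sw_over c = b.
Proof.
move=> lt_t E; have cr : is_cross (pc D (Ordinal lt_t)) by rewrite /= E.
by exists (exist _ (Ordinal lt_t) cr); rewrite /sw_over /ht /= ?E.
Qed.

Lemma corner_exists (c : crossing D) (u r : bool) :
  {p : point D | at_ p (u + ht c) (r + pos D (ht c))}.
Proof.
have lt := ht_lt c; have := pos_bound lt; have := size_level_succ lt.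
rewrite pc_ht /= => E bd; apply: point_at; first by case: u => /=; lia.
by case: u r => [] [] /=; rewrite ?add0n ?add1n; lia.
Qed.

(** The corner of [c] above it iff [u] and to its right iff [r]. *)
Definition corner_of (c : crossing D) (u r : bool) : point D :=
  sval (corner_exists c u r).

Lemma at_corner c (u r : bool) p :
  at_ p (u + ht c) (r + pos D (ht c)) = (p == corner_of c u r).
Proof.
have H := svalP (corner_exists c u r).
by apply/idP/eqP => [/at_inj/(_ H)|->].
Qed.

Lemma nth_corner f c (u r : bool) :
  nth false (colours f (u + ht c)) (r + pos D (ht c)) = f (corner_of c u r).
Proof. exact/nth_colours/(svalP (corner_exists c u r)). Qed.

Lemma cornerP c p :
  reflect (exists ur : bool * bool, p = corner_of c ur.1 ur.2) (corner c p).
Proof.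
have E : corner c p = [|| p == corner_of c false false, p == corner_of c false true,
    p == corner_of c true false | p == corner_of c true true].
  by rewrite -!at_corner.
rewrite E; apply: (iffP or4P) => [|[[u r] ->]].
  by case=> /eqP ->; [exists (false, false)|exists (false, true)
                     |exists (true, false)|exists (true, true)].
by case: u r => [] []; rewrite eqxx; [exact: Or44|exact: Or43|exact: Or42|exact: Or41].
Qed.

(** [v] selects the resolution with vertical arcs. *)
Definition arcs (c : crossing D) (v : bool) : rel (point D) := fun p q =>
  if v then (p == corner_of c false false) && (q == corner_of c true false)
            || (p == corner_of c false true) && (q == corner_of c true true)
  else (p == corner_of c false false) && (q == corner_of c false true)
            || (p == corner_of c true false) && (q == corner_of c true true).

Lemma resolvedE (s : smoothing D) p q :
  resolved s p q = [exists c, arcs c (vertical s c) p q].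
Proof.
by apply: eq_existsb => c; rewrite /arcs -!at_corner.
Qed.

Definition tangle_arc : rel (point D) := fun p q => strand p q || antipodal p q.

(** What smoothings that differ only at [c] have in common. *)
Definition adjacent_off (c : crossing D) (s : smoothing D) : rel (point D) :=
  fun p q => let r p q :=
    tangle_arc p q || [exists c', (c' != c) && arcs c' (vertical s c') p q]
  in r p q || r q p.

Lemma adjacent_off_sym c s : symmetric (adjacent_off c s).
Proof. by move=> p q; rewrite /adjacent_off orbC. Qed.

Lemma adjacent_sym s : symmetric (@adjacent D s).
Proof. by move=> p q; rewrite /adjacent orbC. Qed.

Lemma adjacent_glue c s p q : adjacent s p q =
  glue (adjacent_off c s)
    (corner_of c false false) (corner_of c (vertical s c) (~~ vertical s c))
    (corner_of c (~~ vertical s c) (vertical s c)) (corner_of c true true) p q.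
Proof.
have rE p' q' : [|| strand p' q', antipodal p' q' | resolved s p' q'] =
   (tangle_arc p' q' || [exists c', (c' != c) && arcs c' (vertical s c') p' q'])
   || arcs c (vertical s c) p' q'.
  rewrite resolvedE /tangle_arc orbA -[RHS]orbA; congr (_ || _).
  apply/idP/idP => [/existsP[c' H]|/orP[/existsP[c' /andP[_ H]]|H]].
  - have [<-|ne] := eqVneq c' c; first by rewrite H orbT.
    by apply/orP; left; apply/existsP; exists c'; rewrite ne.
  - by apply/existsP; exists c'.
  - by apply/existsP; exists c.
rewrite /adjacent !rE /glue /adjacent_off /arcs.
by case: (vertical s c) => /=; btauto.
Qed.

End Levels.

Lemma split_two i (s : seq bool) : i + 2 <= size s ->
  s = take i s ++ [:: nth false s i; nth false s i.+1] ++ drop (i + 2) s.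
Proof.
move=> H; rewrite -[LHS](cat_take_drop i); congr (_ ++ _).
rewrite (drop_nth false) ?(drop_nth false (n := i.+1)) /=; [|lia|lia].
by rewrite addn2.
Qed.

(** Cups and caps add or remove two points of the same colour. *)
Lemma flows_parity i g A B :
    i + nin g <= size A -> size B + nin g = size A + nout g -> flows i g A B ->
  odd (count id A) (+) odd (count id B) =
  if g is Cross _ then nth false A i (+) nth false A i.+1
                       (+) (nth false B i (+) nth false B i.+1) else false.
Proof.
move=> bA sB /and4P[/eqP tk /eqP dr cu ca].
have oddE s : i + 2 <= size s -> odd (count id s) =
    odd (count id (take i s)) (+) (nth false s i (+) nth false s i.+1)
    (+) odd (count id (drop (i + 2) s)).
  by move=> H; rewrite {1}(split_two H) !count_cat !oddD /= !oddb addbF !addbA.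
case: g => [o||b] /= in bA sB dr cu ca *.
- rewrite (@oddE B); last lia.
  rewrite -tk -dr (eqP cu) addn0 addbb addbF -oddD -count_cat cat_take_drop.
  exact: addbb.
- rewrite (@oddE A); last lia.
  rewrite tk dr (eqP ca) addn0 addbb addbF -oddD -count_cat cat_take_drop.
  exact: addbb.
- rewrite (@oddE A) ?(@oddE B); [|lia|lia]; rewrite tk dr.
  have cancel x y p q : (p (+) x (+) q) (+) (p (+) y (+) q) = x (+) y.
    by case: x y p q => [] [] [] [].
  exact: cancel.
Qed.

(** By hypothesis, a class contains none, two or all of the four points. *)
Lemma even_classes_pairing (T : Type) (r : rel T) (a b c d : T) :
    reflexive r -> symmetric r -> transitive r ->
    (forall x, r x a (+) r x c (+) (r x b (+) r x d) = false) ->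
  [\/ r a b && r c d, r a c && r b d | r a d && r b c].
Proof.
move=> rr rs rt par.
have rE x y z : r x y -> r x z = r y z.
  by move=> xy; apply/idP/idP; apply: rt; rewrite // rs.
have Eb := @rE a b; have Ec := @rE a c; have Ed := @rE a d.
have := (par a, par b, par c, par d); rewrite !rr (rs b a) (rs c a) (rs d a) (rs c b)
  (rs d b) (rs d c).
have := (Eb c, Eb d, Ec b, Ec d, Ed b, Ed c); rewrite (rs c b) (rs d b) (rs d c).
case: (r a b); case: (r a c); case: (r a d); case: (r b c); case: (r b d);
  case: (r c d) => -[[[[[e1 e2] e3] e4] e5] e6] -[[[p1 p2] p3] p4] //;
  try (by [exact: Or31|exact: Or32|exact: Or33]);
  by [move: (e1 isT) | move: (e2 isT) | move: (e3 isT) | move: (e4 isT)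
     | move: (e5 isT) | move: (e6 isT)].
Qed.

Section Resolutions.

Variable D : diagram.
Implicit Types (f : point D -> bool) (c : crossing D) (s : smoothing D).

Definition compatible f c (v : bool) : bool :=
  let at_corner := fun u r => f (corner_of c u r) in
  if v then (at_corner false false == at_corner true false)
            && (at_corner false true == at_corner true true)
  else (at_corner false false == at_corner false true)
            && (at_corner true false == at_corner true true).

Lemma compatibleP f c v :
  reflect (forall p q, arcs c v p q -> f p = f q) (compatible f c v).
Proof.
apply: (iffP idP) => [H p q | H].
  by move: H; rewrite /compatible /arcs; case: v => /andP[/eqP E1 /eqP E2] /orP[]
    /andP[/eqP -> /eqP ->].
by rewrite /compatible; case: v H => H; apply/andP; split; apply/eqP/H;
  rewrite /arcs !eqxx ?orbT.
Qed.

Definition tangle_colouring f : bool :=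
  [forall p, forall q, tangle_arc p q ==> (f p == f q)].

Lemma tangle_colouringP f :
  reflect (forall p q, tangle_arc p q -> f p = f q) (tangle_colouring f).
Proof.
apply: (iffP forallP) => [H p q pq | H p].
  by apply/eqP; move: (H p) => /forallP/(_ q)/implyP; apply.
by apply/forallP => q; apply/implyP => /H ->.
Qed.

Lemma tangle_colouring_levels f :
  tangle_colouring f <->
  (forall t, t < size (word D) ->
     flows (pos D t) (pc D t) (colours f t) (colours f t.+1)) /\
  colours f (size (word D)) = rev (colours f 0).
Proof.
split=> [/tangle_colouringP H | [/strand_flows H1 /antipodal_colours H2]].
  split; first by apply/strand_flows => p q pq; apply: H; rewrite /tangle_arc pq.
  by apply/antipodal_colours => p q pq; apply: H; rewrite /tangle_arc pq orbT.
by apply/tangle_colouringP => p q /orP[/H1|/H2].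
Qed.

Lemma constant_on_circlesE (x : enhanced D) : constant_on_circles x =
  tangle_colouring (lab x) && [forall c, compatible (lab x) c (vertical (sm x) c)].
Proof.
apply/idP/andP => [/forallP H | [/tangle_colouringP H1 /forallP H2]].
  have inv p q : adjacent (sm x) p q -> lab x p = lab x q.
    move=> pq; move: (H p) => /forallP/(_ q); rewrite inE.
    by rewrite (connect1 pq) /= => /eqP ->.
  split; first by apply/tangle_colouringP => p q /orP[] pq; apply: inv; rewrite /adjacent pq ?orbT.
  apply/forallP => c; apply/compatibleP => p q pq; apply: inv.
  have rs : resolved (sm x) p q by rewrite resolvedE; apply/existsP; exists c.
  by rewrite /adjacent rs !orbT.
have inv p q : adjacent (sm x) p q -> lab x p = lab x q.
  have half p' q' : [|| strand p' q', antipodal p' q' | resolved (sm x) p' q'] ->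
      lab x p' = lab x q'.
    rewrite resolvedE orbA => /orP[/H1 //|/existsP[c]].
    by have /compatibleP := H2 c; apply.
  by case/orP => /half.
apply/forallP => p; apply/forallP => q; apply/implyP; rewrite inE => pq.
by rewrite eq_sym; apply/eqP; exact: connect_invariant pq.
Qed.

(** A class of the diagram with one crossing cut out has an even number of ends
    at that crossing; [f] is the indicator function of a union of classes.
    Sweeping the disc, the parity of the number of points of the class on a
    level can only change at the crossing, and the top level has as many of them
    as the bottom level. *)
Lemma corner_parity f c s :
    (forall p q, adjacent_off c s p q -> f p = f q) ->
  f (corner_of c false false) (+) f (corner_of c false true)
    (+) (f (corner_of c true false) (+) f (corner_of c true true)) = false.
Proof.
move=> inv; set X := LHS.
have /tangle_colouring_levels[fl cl] : tangle_colouring f.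
  by apply/tangle_colouringP => p q pq; apply: inv; rewrite /adjacent_off pq.
pose par t := odd (count id (colours f t)).
have step t : t < size (word D) -> par t.+1 = par t (+) ((ht c == t) && X).
  move=> lt_t; have := flows_parity _ _ (fl t lt_t).
  rewrite !size_colours => /(_ (pos_bound lt_t) (size_level_succ lt_t)).
  rewrite -/(par t) -/(par t.+1) => E.
  suff -> : (ht c == t) && X = par t (+) par t.+1 by rewrite addKb.
  rewrite E; case Epc: (pc D t) => [o||b]; try by
    case: eqP => // E'; rewrite -E' pc_ht in Epc.
  have [c' Ec' _] := crossing_at lt_t Epc; rewrite -Ec'.
  rewrite (nth_corner f c' false false) (nth_corner f c' false true).
  rewrite (nth_corner f c' true false) (nth_corner f c' true true).
  case: eqP => [/ht_inj <-|ne] //=.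
  have /compatibleP : forall p q, arcs c' (vertical s c') p q -> f p = f q.
    move=> p q pq; apply: inv; rewrite /adjacent_off.
    apply/orP; left; apply/orP; right; apply/existsP; exists c'; rewrite pq andbT.
    by apply/eqP => E'; apply: ne; rewrite E'.
  by rewrite /compatible; case: ifP => _ /andP[/eqP-> /eqP->]; rewrite ?addbb.
have tele t : t <= size (word D) -> par t = par 0 (+) ((ht c < t) && X).
  elim: t => [|t IH] lt_t; first by rewrite addbF.
  rewrite step // (IH (ltnW lt_t)) -addbA -andb_addl; congr (_ (+) (_ && X)).
  rewrite ltnS [in RHS]leq_eqVlt; case: eqP => [->|_] /=; last exact: addbF.
  by rewrite ltnn.
have := tele _ (leqnn _); rewrite ht_lt /= {1}/par cl count_rev -/(par 0).
by case: (par 0); case: (X).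
Qed.

Definition agree_off c s s' : Prop := forall c', c' != c -> s c' = s' c'.

Lemma adjacent_off_agree c s s' : agree_off c s s' ->
  adjacent_off c s =2 adjacent_off c s'.
Proof.
move=> E p q; rewrite /adjacent_off.
by congr ((_ || _) || (_ || _)); apply: eq_existsb => c'; case: eqVneq => //= ne;
  rewrite /vertical E.
Qed.

Lemma corner_pairing c s :
  let r := connect (adjacent_off c s) in let p := corner_of c in
  [\/ r (p false false) (p true false) && r (p false true) (p true true),
      r (p false false) (p false true) && r (p true false) (p true true)
    | r (p false false) (p true true) && r (p true false) (p false true)].
Proof.
move=> r p; have rs : symmetric r := sym_connect_sym (@adjacent_off_sym D c s).
have par a : r a (p false false) (+) r a (p false true)
    (+) (r a (p true false) (+) r a (p true true)) = false.
  apply: (corner_parity (s := s)) => x y xy; rewrite ![r a _]rs.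
  exact/same_connect/connect1.
apply: even_classes_pairing par => [a | x y | y x z]; first exact: connect0.
  exact: rs.
exact: connect_trans.
Qed.

End Resolutions.

(** * Merging, splitting and one-to-one bifurcations *)
Lemma addrr_F2 (x : 'F_2) : (x + x = 0)%R.
Proof. by rewrite -mulr2n -mulr_natr (_ : 2%:R = 0)%R ?mulr0 //; apply/eqP. Qed.

Lemma sum_mem_seq (T : finType) (P : pred T) (A : pred T) (F : T -> 'F_2) (s : seq T) :
    uniq s -> (forall y, y \in s = P y && A y) ->
  (\sum_(y | P y) (A y)%:R * F y = \sum_(y <- s) F y)%R.
Proof.
move=> us sE; rewrite big_uniq //= (eq_bigl _ _ sE) big_mkcondr /=.
by apply: eq_bigr => y _; case: (A y); rewrite ?mul1r ?mul0r.
Qed.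

Section Bifurcation.

Variable D : diagram.
Implicit Types (c : crossing D) (s : smoothing D) (x y z : enhanced D).

Definition same_circle s : rel (point D) := connect (adjacent s).

Lemma same_circle_sym s : symmetric (same_circle s).
Proof. exact: sym_connect_sym (@adjacent_sym D s). Qed.

Lemma same_circle_refl s : reflexive (same_circle s).
Proof. by move=> p; exact: connect0. Qed.

Lemma same_circleE s p q : same_circle s p q -> same_circle s p =1 same_circle s q.
Proof. exact: same_connect (same_circle_sym s) p q. Qed.

Lemma same_circle_equivalence s : equivalence_rel (same_circle s).
Proof.
by move=> p q r; split=> [|/same_circleE ->] //; exact: same_circle_refl.
Qed.

Lemma circlesE s : circles s = [set [set q | same_circle s p q] | p : point D].
Proof. by []. Qed.

Lemma constantP x :
  reflect (forall p q, same_circle (sm x) p q -> lab x p = lab x q)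
          (constant_on_circles x).
Proof.
apply: (iffP forallP) => [H p q pq | H p].
  by move: (H p) => /forallP/(_ q); rewrite inE -/(same_circle _ _ _) pq /= => /eqP.
by apply/forallP => q; apply/implyP; rewrite inE => /H ->.
Qed.

Lemma involvedP c s p :
  reflect (exists2 q, same_circle s p q & corner c q) (involved c s p).
Proof.
apply: (iffP existsP) => [[q /andP[]]|[q pq cq]]; first by rewrite inE; exists q.
by exists q; rewrite cq andbT inE.
Qed.

(** The corners meet exactly the classes of [a] and [b], so that these are the
    circles involved in the bifurcation. *)
Definition unites c (K K' : rel (point D)) a b : Prop :=
  [/\ corner c a, corner c b, merged K K' a b
    & forall p, corner c p -> K a p || K b p].

(** The hypotheses are symmetric in [s] and [s'], so the vertical resolution may
    be assumed to come first. *)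
Lemma bifurcation c s s' : agree_off c s s' -> s c != s' c ->
  let K := same_circle s in let K' := same_circle s' in
  [\/ K =2 K', exists a b, unites c K K' a b | exists a b, unites c K' K a b].
Proof.
move=> agree ne K K'.
wlog vs : s s' agree ne @K @K' / vertical s c => [H|].
  have [/H|nvs] := boolP (vertical s c); first exact.
  have vs' : vertical s' c.
    by move: ne nvs; rewrite /vertical; case: (sw_over c); case: (s c); case: (s' c).
  have [||E|E|E] := H s' s _ _ vs'.
  - by move=> c' /agree.
  - by rewrite eq_sym.
  - by apply: Or31 => p q; exact/esym/E.
  - exact: Or33.
  - exact: Or32.
have nvs' : vertical s' c = false.
  by move: ne vs; rewrite /vertical; case: (sw_over c); case: (s c); case: (s' c).
have cor u r : corner c (corner_of c u r) by apply/cornerP; exists (u, r).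
have := resolution_trichotomy (@adjacent_off_sym D c s) (corner_pairing c s).
set G := connect _; set G' := connect (glue _ _ _ _ _).
have GE : K =2 G.
  by apply: eq_connect => p q; rewrite (adjacent_glue c) vs.
have GE' : K' =2 G'.
  apply: eq_connect => p q; rewrite (adjacent_glue c) nvs' /glue.
  by rewrite (adjacent_off_agree agree).
case=> [E|[[nab mE] /andP[H1 H2]]|[[nab mE] /andP[H1 H2]]].
- by apply: Or31 => p q; rewrite GE GE'.
- apply: Or32; exists (corner_of c false false), (corner_of c false true).
  split=> // [|p /cornerP[[u r] ->]]; first by split=> [|p q]; rewrite ?GE // GE' mE.
  rewrite !GE; case: u r => [] [] /=; rewrite ?H1 ?H2 ?orbT //.
    by rewrite /G connect0 orbT.
  by rewrite /G connect0.
- apply: Or33; exists (corner_of c false false), (corner_of c true false).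
  split=> // [|p /cornerP[[u r] ->]]; first by split=> [|p q]; rewrite ?GE' // GE mE.
  rewrite !GE'; case: u r => [] [] /=; rewrite ?H1 ?H2 ?orbT //.
    by rewrite /G' connect0 orbT.
  by rewrite /G' connect0.
Qed.

Lemma unites_card c s s' a b : unites c (same_circle s) (same_circle s') a b ->
  #|circles s| = #|circles s'|.+1.
Proof. by case=> _ _ m _; exact: card_merged (same_circle_equivalence s) m. Qed.

(** * From labels to idempotents *)
Definition flip c s : smoothing D := [ffun c' => (c' == c) (+) s c'].

Lemma flipE c s c' : flip c s c' = (c' == c) (+) s c'.
Proof. by rewrite ffunE. Qed.

Lemma flipK c : involutive (flip c).
Proof. by move=> s; apply/ffunP => c'; rewrite !flipE addKb. Qed.

Lemma flipC c c' s : flip c (flip c' s) = flip c' (flip c s).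
Proof. by apply/ffunP => e; rewrite !flipE addbCA. Qed.

Lemma edgeE c s s' : edge c s s' = ~~ s c && (s' == flip c s).
Proof.
rewrite /edge; case sc: (s c) => //=; apply/andP/eqP => [[s'c /forallP H]|->].
  apply/ffunP => c'; rewrite flipE; case: eqVneq => [->|ne] /=; first by rewrite s'c sc.
  by have := H c'; rewrite ne => /eqP.
rewrite flipE eqxx sc; split=> //; apply/forallP => c'.
by apply/implyP => ne; rewrite flipE (negbTE ne).
Qed.

Lemma flip_inj s : injective (fun c => flip c s).
Proof.
move=> c c' /ffunP/(_ c); rewrite !flipE eqxx.
by case: eqP => // _; case: (s c).
Qed.

Definition ones s : nat := #|[set c | s c]|.

Lemma ones_edge c s s' : edge c s s' -> ones s' = (ones s).+1.
Proof.
rewrite edgeE => /andP[sc /eqP ->].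
rewrite /ones [LHS](cardsD1 c) inE flipE eqxx (negbTE sc) /= add1n.
congr _.+1; apply: eq_card => c'; rewrite !inE flipE.
by case: eqVneq => [->|_] /=; rewrite ?(negbTE sc).
Qed.

(** Along an edge, a merging or a splitting changes both terms by one, and a
    one-to-one bifurcation only the second. Adding [twist] to the superscript
    therefore cancels the exchange of superscripts by [eta2]. *)
Definition twist s : bool := odd (#|circles s| + ones s).

(** The change of basis. On each circle v_+ = a + b and v_- = b; when the
    idempotents a and b are written as [true] and [false], a basis vector is the sum
    of the colourings below its labelling. The matrix is its own inverse over
    F_2 ([zeta_zeta]). *)
Definition zeta x y : bool :=
  [&& sm x == sm y, sup y == sup x (+) twist (sm x)
    & [forall p, lab y p ==> lab x p]].

(** The differential in the basis of idempotents. Both ends being constant on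
    their own circles, the colours at the crossing are equal. *)
Definition cube_edge x y : bool :=
  [&& [exists c, edge c (sm x) (sm y)], x.1.2 == y.1.2 & sup x == sup y].

Definition enhance s (l : point D -> bool) (u : bool) : enhanced D := (s, [ffun p => l p], u).

Lemma smE s l u : sm (enhance s l u) = s. Proof. by []. Qed.
Lemma supE s l u : sup (enhance s l u) = u. Proof. by []. Qed.
Lemma labE s l u : lab (enhance s l u) =1 l.
Proof. by move=> p; rewrite /lab /= ffunE. Qed.

Lemma enhancedP x y : sm x = sm y -> lab x =1 lab y -> sup x = sup y -> x = y.
Proof.
case: x y => [[s l] u] [[s' l'] u']; rewrite /sm /sup /lab /= => -> E ->.
by congr (_, _, _); apply/ffunP.
Qed.

End Bifurcation.

Section Incidence.

Variable D : diagram.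
Implicit Types (c : crossing D) (s : smoothing D) (x y z : enhanced D).

Lemma edge_unique c c' s s' : edge c s s' -> edge c' s s' -> c = c'.
Proof.
rewrite !edgeE => /andP[_ /eqP ->] /andP[_ /eqP E].
exact: (flip_inj (s := s)).
Qed.

Lemma edge_agree c s s' : edge c s s' -> agree_off c s s' /\ s c != s' c.
Proof.
rewrite edgeE => /andP[sc /eqP ->]; split=> [c' ne|]; rewrite flipE ?eqxx.
  by rewrite (negbTE ne).
by case: (s c).
Qed.

Lemma incident_edge c x y : edge c (sm x) (sm y) -> incident x y =
  [forall p, ~~ involved c (sm x) p ==> (lab y p == lab x p)] &&
  (if #|circles (sm y)| < #|circles (sm x)| then merges c x y
   else if #|circles (sm x)| < #|circles (sm y)| then splits c x y
   else switches c x y).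
Proof.
move=> e; apply/existsP/idP => [[c' /and3P[e' H1 H2]]|/andP[H1 H2]].
  by rewrite (edge_unique e e') H1.
by exists c; rewrite e H1.
Qed.

(** At most one intermediate term: the smoothing of [x] with the colours of [z]. *)
Lemma zeta_cube_sum x z :
  (\sum_(y | constant_on_circles y) (zeta x y)%:R * (cube_edge y z)%:R =
   [&& [exists c, edge c (sm x) (sm z)],
       constant_on_circles (enhance (sm x) (lab z) (sup z))
     & zeta x (enhance (sm x) (lab z) (sup z))]%:R :> 'F_2)%R.
Proof.
set y0 := enhance _ _ _; set E := [exists c, _].
transitivity (\sum_(y | constant_on_circles y) (y == y0)%:R * (E && zeta x y0)%:R : 'F_2)%R.
  apply: eq_bigr => y _; rewrite -!natrM; congr (_%:R)%R; rewrite !mulnb; congr nat_of_bool.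
  have [-> | ne] := eqVneq y y0.
    by rewrite /cube_edge smE -/E supE eqxx (_ : y0.1.2 = z.1.2) ?eqxx ?andbT 1?andbC //;
      apply/ffunP => p; rewrite ffunE.
  apply/negbTE; apply: contra ne => /andP[/and3P[/eqP sx _ _] /and3P[_ /eqP l /eqP u]].
  apply/eqP/enhancedP; rewrite ?smE ?supE // => p.
  by rewrite labE /lab l.
case: (boolP (constant_on_circles y0)) => C0; rewrite ?andbF ?andbT /=.
  rewrite (@sum_mem_seq _ _ _ _ [:: y0]) // ?big_seq1 // => y.
  by rewrite inE; case: eqP => [->|]; rewrite ?C0 ?andbF.
rewrite big1 // => y Cy; case: eqP => [E'|]; last by rewrite mul0r.
by rewrite -E' Cy in C0.
Qed.

(** The differential expressed in the basis of idempotents. Only the circles at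
    the changed crossing matter, and the three kinds of bifurcation are checked
    separately. *)
Lemma incident_zeta x z :
    constant_on_circles x -> constant_on_circles z ->
  (\sum_(y | constant_on_circles y) (incident x y)%:R * (zeta y z)%:R =
   \sum_(y | constant_on_circles y) (zeta x y)%:R * (cube_edge y z)%:R :> 'F_2)%R.
Proof.
move=> Cx Cz; rewrite zeta_cube_sum; set y1 := enhance _ _ _.
case: (boolP [exists c, _]) => [/existsP[c e]|ne]; last first.
  rewrite big1 // => y _; case inc: (incident x y); rewrite ?mul0r //.
  case ze: (zeta y z); rewrite ?mulr0 //.
  case/existsP: inc => c /and3P[e _ _]; case/and3P: ze => /eqP E _ _.
  by case/existsP: ne; exists c; rewrite -E.
rewrite /=.
set s := sm x in e *; set s' := sm z in e *.
have tw := ones_edge e; have [agr sc] := edge_agree e.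
pose A y := incident x y && (sm y == s').
rewrite (eq_bigr (fun y => (A y)%:R * (zeta y z)%:R : 'F_2)%R); last first.
  move=> y _; rewrite -!natrM; congr (_%:R)%R; rewrite !mulnb; congr nat_of_bool.
  by rewrite /A /zeta -/s'; case: (sm y == s'); rewrite ?andbT ?andbF.
have AE y : sm y = s' -> A y = [forall p, ~~ involved c s p ==> (lab y p == lab x p)] &&
    (if #|circles s'| < #|circles s| then merges c x y
     else if #|circles s| < #|circles s'| then splits c x y else switches c x y).
  by move=> E; rewrite /A E eqxx andbT (@incident_edge c) E.
have An y : sm y <> s' -> A y = false by move=> E; rewrite /A; case: eqP => //; rewrite andbF.
have xK p q : same_circle s p q -> lab x p = lab x q := elimT (constantP x) Cx p q.
have zK p q : same_circle s' p q -> lab z p = lab z q := elimT (constantP z) Cz p q.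
case: (bifurcation agr sc) => [KE|[a [b U]]|[a [b U]]].
- (* The only term keeps all labels and exchanges the superscript. *)
  have cE : #|circles s'| = #|circles s|.
    rewrite (_ : circles s' = circles s) // !circlesE; apply: eq_imset => p.
    by apply/setP => q; rewrite !inE KE.
  have twE : twist s' = ~~ twist s by rewrite /twist cE tw addnS.
  pose y0 := enhance s' (lab x) (~~ sup x).
  rewrite (@sum_mem_seq _ _ _ _ [:: y0]) ?big_seq1 //; last first.
    move=> y; rewrite inE; apply/eqP/andP => [->|[Cy Ay]].
      split; first by apply/constantP => p q; rewrite smE !labE -KE; exact: xK.
      rewrite AE // cE ltnn; apply/andP; split.
        by apply/forallP => p; rewrite labE eqxx implybT.
      rewrite /switches supE eqxx; apply/forallP => p; rewrite labE eqxx; exact: implybT.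
    have [sy|/eqP/An E] := eqVneq (sm y) s'; last by rewrite E in Ay.
    move: Ay; rewrite AE // cE ltnn => /andP[/forallP H1 /andP[/eqP H2 /forallP H3]].
    have yK p q : same_circle s' p q -> lab y p = lab y q.
      by rewrite -sy => /(elimT (constantP y) Cy).
    apply: enhancedP; rewrite ?smE ?supE // => p; rewrite labE.
    have [/involvedP[q pq cq]|ni] := boolP (involved c s p); last first.
      by have := H1 p; rewrite ni => /eqP.
    have := H3 q; rewrite cq => /eqP E.
    by rewrite (xK _ _ pq) -E; apply: yK; rewrite -KE.
  congr (_%:R)%R; congr nat_of_bool.
  have -> : constant_on_circles y1.
    by apply/constantP => p q; rewrite smE !labE KE; exact: zK.
  rewrite /zeta !smE !supE !eqxx twE /=.
  congr (_ && _); first by case: (sup x); case: (twist s).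
  by apply: eq_forallb => p; rewrite !labE.
- (* The only term gives the united circle the minimum of the two labels, and a
     colour is below the minimum iff it is below both. *)
  have cE := unites_card U; case: U => ca cb m cov.
  have twE : twist s' = twist s by rewrite /twist cE tw addSnnS.
  case: m => nab K'E.
  have K'a p : same_circle s' a p = same_circle s a p || same_circle s b p.
    by rewrite K'E same_circle_refl /=; case: (same_circle s a p).
  have inv p : involved c s p = same_circle s' a p.
    rewrite K'a; apply/involvedP/orP => [[q pq /cov]|[]]; last 2 first.
    - by exists a; rewrite // same_circle_sym.
    - by exists b; rewrite // same_circle_sym.
    rewrite ![same_circle s _ q]same_circle_sym -!(same_circleE pq).
    by rewrite ![same_circle s p _]same_circle_sym => /orP.
  pose y0 := enhance s'
    (fun p => if same_circle s' a p then lab x a && lab x b else lab x p) (sup x).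
  have y0C p q : same_circle s' p q -> lab y0 p = lab y0 q.
    move=> pq; rewrite !labE; have E : same_circle s' a p = same_circle s' a q.
      by rewrite ![same_circle s' a _]same_circle_sym (same_circleE pq).
    rewrite -E; case: ifP => // nap; apply: xK; move: pq; rewrite K'E.
    by case/orP=> // /andP[]; rewrite -K'a nap.
  rewrite (@sum_mem_seq _ _ _ _ [:: y0]) ?big_seq1 //; last first.
    move=> y; rewrite inE; apply/eqP/andP => [->|[Cy Ay]].
      split; first exact/constantP.
      rewrite AE // cE ltnSn; apply/andP; split.
        by apply/forallP => p; rewrite labE inv; case: ifP; rewrite ?eqxx.
      rewrite /merges supE eqxx; apply/forallP => p; apply/forallP => q.
      apply/implyP => /and3P[/cov cp /cov cq]; rewrite inE -/(same_circle _ _ _) labE K'a cp /m2.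
      case/orP: cp => ap; rewrite -(same_circleE ap) -/s => np; rewrite -(xK _ _ ap).
        by rewrite (negbTE np) /= in cq; rewrite -(xK _ _ cq).
      by rewrite (negbTE np) orbF in cq; rewrite -(xK _ _ cq) andbC.
    have [sy|/eqP/An E] := eqVneq (sm y) s'; last by rewrite E in Ay.
    move: Ay; rewrite AE // cE ltnSn => /andP[/forallP H1 /andP[/eqP H2 /forallP H3]].
    have yK p q : same_circle s' p q -> lab y p = lab y q.
      by rewrite -sy => /(elimT (constantP y) Cy).
    apply: enhancedP; rewrite ?smE ?supE // => p; rewrite labE.
    case: ifP => ap; last by have := H1 p; rewrite inv ap => /eqP.
    rewrite -(yK _ _ ap); move: (H3 a) => /forallP/(_ b).
    by rewrite ca cb inE -/(same_circle _ _ _) nab => /eqP.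
  congr (_%:R)%R; congr nat_of_bool.
  have -> : constant_on_circles y1.
    by apply/constantP => p q; rewrite smE !labE => pq; apply: zK; rewrite K'E pq.
  rewrite /zeta !smE !supE !eqxx twE /=; congr (_ && _).
  have ab : same_circle s' a b by rewrite K'a same_circle_refl orbT.
  apply/forallP/forallP => H p; apply/implyP; rewrite !labE => zp.
    have := H p; rewrite zp labE /= K'a.
    have [ap|_] /= := boolP (same_circle s a p); first by rewrite -(xK _ _ ap) => /andP[].
    by have [bp|] // := boolP (same_circle s b p); rewrite -(xK _ _ bp) => /andP[].
  case: ifP => ap; last by have := H p; rewrite labE zp.
  have := H a; have := H b; rewrite !labE -(zK _ _ ab) (zK _ _ ap) zp /=.
  by move=> -> ->.
- (* If [lab x a] is v_+, the summands of Delta_2(v_+) above a pair of colours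
     number 1 for (a, a), 3 for (b, b) and 2 for the two mixed pairs: they are
     odd in number exactly when the colours agree. *)
  have cE := unites_card U; case: U => ca cb m cov.
  have twE : twist s' = twist s by rewrite /twist cE tw addSn addnS /= negbK.
  case: m => nab KE.
  have Ka p : same_circle s a p = same_circle s' a p || same_circle s' b p.
    by rewrite KE same_circle_refl /=; case: (same_circle s' a p).
  have inv p : involved c s p = same_circle s a p.
    apply/involvedP/idP => [[q pq /cov]|]; last by exists a; rewrite // same_circle_sym.
    by rewrite -Ka [same_circle s a q]same_circle_sym -(same_circleE pq) same_circle_sym.
  have disj p : same_circle s' a p -> same_circle s' b p = false.
    move=> ap; apply: contraNF nab; rewrite same_circle_sym -(same_circleE ap).
    by [].
  pose y0 (w : bool * bool) := enhance s' (fun p => if same_circle s' a p then w.1 else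
    if same_circle s' b p then w.2 else lab x p) (sup x).
  have y0a w p : same_circle s' a p -> lab (y0 w) p = w.1 by rewrite labE => ->.
  have y0b w p : same_circle s' b p -> lab (y0 w) p = w.2.
    move=> bp; rewrite labE bp; case: ifP => // /disj; by rewrite bp.
  have y0C w p q : same_circle s' p q -> lab (y0 w) p = lab (y0 w) q.
    move=> pq; rewrite !labE.
    have E d : same_circle s' d p = same_circle s' d q.
      by rewrite ![same_circle s' d _]same_circle_sym (same_circleE pq).
    by rewrite !E; do 2 case: ifP => // _; apply: xK; rewrite KE pq.
  rewrite (@sum_mem_seq _ _ _ _ [seq y0 w | w <- Delta2 (lab x a)]); first last.
  + move=> y; apply/mapP/andP => [[w wD ->]|[Cy Ay]].
      split; first exact/constantP/y0C.
      rewrite AE // cE ltnNge leqnSn /= ltnSn; apply/andP; split.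
        apply/forallP => p; rewrite labE inv Ka.
        by case: (same_circle s' a p) => //=; case: (same_circle s' b p) => /=.
      rewrite /splits supE eqxx; apply/forallP => p; apply/forallP => q.
      apply/implyP => /and3P[/cov cp /cov cq]; rewrite inE -/(same_circle _ _ _) smE => npq.
      have -> : lab x p = lab x a by apply/esym/xK; rewrite Ka.
      case/orP: cp => ap; rewrite -(same_circleE ap) in npq.
        by rewrite (negbTE npq) in cq; rewrite (y0a _ _ ap) (y0b _ _ cq); case: w wD {npq}.
      rewrite (negbTE npq) orbF in cq; rewrite (y0b _ _ ap) (y0a _ _ cq).
      by case: w wD => [[] []]; case: (lab x a).
    have [sy|/eqP/An E] := eqVneq (sm y) s'; last by rewrite E in Ay.
    move: Ay; rewrite AE // cE ltnNge leqnSn /= ltnSn.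
    case/andP=> /forallP H1 /andP[/eqP H2 /forallP H3].
    have yK p q : same_circle s' p q -> lab y p = lab y q.
      by rewrite -sy => /(elimT (constantP y) Cy).
    exists (lab y a, lab y b).
      move: (H3 a) => /forallP/(_ b).
      by rewrite ca cb inE -/(same_circle _ _ _) sy nab.
    apply: enhancedP; rewrite ?smE ?supE // => p.
    case Ap: (same_circle s' a p); first by rewrite y0a // (yK _ _ Ap).
    case Bp: (same_circle s' b p); first by rewrite y0b // (yK _ _ Bp).
    by rewrite labE Ap Bp; have := H1 p; rewrite inv Ka Ap Bp => /eqP.
  + rewrite map_inj_uniq; first by case: (lab x a).
    move=> w w' E; have := congr1 (fun y => (lab y a, lab y b)) E.
    rewrite !(y0a _ a) ?same_circle_refl // !(y0b _ b) ?same_circle_refl //.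
    by case: w {E} => ? ?; case: w'.
  pose Z := (sup z == sup x (+) twist s') &&
            [forall p, ~~ same_circle s a p ==> (lab z p ==> lab x p)].
  have zy w : zeta (y0 w) z = [&& Z, lab z a ==> w.1 & lab z b ==> w.2].
    rewrite /zeta !smE !supE !eqxx /= /Z -andbA; congr (_ && _).
    apply/forallP/and3P => [H|[/forallP H Ha Hb] p].
      split; last 2 first.
      - by have := H a; rewrite y0a // same_circle_refl.
      - by have := H b; rewrite y0b // same_circle_refl.
      apply/forallP => p; apply/implyP; rewrite Ka => /norP[np nq].
      by have := H p; rewrite labE (negbTE np) (negbTE nq).
    case Ap: (same_circle s' a p); first by rewrite y0a // -(zK _ _ Ap).
    case Bp: (same_circle s' b p); first by rewrite y0b // -(zK _ _ Bp).
    by rewrite labE Ap Bp; have := H p; rewrite Ka Ap Bp.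
  have cy : constant_on_circles y1 = (lab z a == lab z b).
    apply/constantP/eqP => [H|E p q].
      by have := H a b; rewrite smE !labE => -> //; rewrite Ka same_circle_refl orbT.
    rewrite smE !labE KE; case/orP => [/zK //|/andP[]].
    by case/orP=> /zK <- /orP[] /zK <-.
  have xy : zeta x y1 = [&& Z, lab z a ==> lab x a & lab z b ==> lab x a].
    rewrite /zeta !smE !supE !eqxx /= /Z twE -andbA; congr (_ && _).
    apply/forallP/and3P => [H|[/forallP H Ha Hb] p].
      split; last 2 first.
      - by have := H a; rewrite labE.
      - have := H b; rewrite labE (_ : lab x b = lab x a) //.
        by apply/esym/xK; rewrite Ka same_circle_refl orbT.
      by apply/forallP => p; apply/implyP => _; have := H p; rewrite labE.
    rewrite labE; case Ap: (same_circle s a p); last by have := H p; rewrite Ap.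
    rewrite -(xK _ _ Ap); move: Ap; rewrite Ka => /orP[] /zK <- //.
  rewrite big_map (eq_bigr (fun w => [&& Z, lab z a ==> w.1 & lab z b ==> w.2]%:R)%R); last first.
    by move=> w _; rewrite zy.
  rewrite cy xy; clear zy xy; case: Z; case: (lab x a); case: (lab z a); case: (lab z b);
    rewrite /Delta2 ?big_cons ?big_nil //=; exact/eqP.
Qed.

End Incidence.

(** * The cube of a colouring *)

(** A fixed point free involution pairs off the terms of a sum over F_2; that it
    has no fixed point is witnessed by a predicate [b] which it negates. *)
Lemma sum_toggle (T : finType) (P b : pred T) (f : T -> T) :
    involutive f -> (forall y, P y -> P (f y)) -> (forall y, P y -> b (f y) = ~~ b y) ->
  (\sum_(y | P y) 1 = 0 :> 'F_2)%R.
Proof.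
move=> fK Pf bf; have PfE y : P (f y) = P y.
  by apply/idP/idP => /Pf; rewrite ?fK.
rewrite (bigID b) /= [X in (_ + X)%R](reindex_inj (can_inj fK)) /=.
rewrite [X in (_ + X)%R](eq_bigl (fun y => P y && b y)) ?addrr_F2 // => y.
by rewrite PfE; case: (boolP (P y)) => //= /bf ->; rewrite negbK.
Qed.

Lemma sum_mulb (T : finType) (P A B : pred T) :
  (\sum_(y | P y) (A y)%:R * (B y)%:R = \sum_(y | [&& P y, A y & B y]) 1 :> 'F_2)%R.
Proof.
rewrite [RHS]big_mkcondr /=; apply: eq_bigr => y _.
by rewrite -natrM mulnb; case: (_ && _).
Qed.

Section Cube.

Variable D : diagram.
Implicit Types (c : crossing D) (s : smoothing D) (x y z : enhanced D).

(** Only labellings between those of [z] and [x] contribute. If these two differ,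
    some circle has the label v_+ in [x] and v_- in [z], and its label in an
    intermediate term is arbitrary. *)
Lemma zeta_zeta x z : constant_on_circles x -> constant_on_circles z ->
  (\sum_(y | constant_on_circles y) (zeta x y)%:R * (zeta y z)%:R = (x == z)%:R :> 'F_2)%R.
Proof.
move=> Cx Cz; rewrite sum_mulb.
have zz y : zeta x y -> zeta y z -> [/\ sm y = sm x, sm z = sm x, sup z = sup x,
    sup y = sup x (+) twist (sm x) & forall p, (lab z p ==> lab y p) && (lab y p ==> lab x p)].
  case/and3P=> /eqP s1 /eqP u1 /forallP l1 /and3P[/eqP s2 /eqP u2 /forallP l2].
  by split; rewrite -?s2 -?s1 // ?u2 ?u1 -?s1 ?addbK // => p; rewrite l1 l2.
have [E|ne] := eqVneq x z; [subst z|].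
  pose y0 := enhance (sm x) (lab x) (sup x (+) twist (sm x)).
  rewrite (eq_bigl (pred1 y0)) ?big_pred1_eq // => y /=; apply/and3P/eqP => [[Cy Z1 Z2]|->].
    have [s1 _ _ u1 l1] := zz y Z1 Z2.
    apply: enhancedP => // p; rewrite labE; have := l1 p.
    by case: (lab x p); case: (lab y p).
  split; first by apply/constantP => p q; rewrite smE !labE; exact: (elimT (constantP x) Cx).
    rewrite /zeta smE supE !eqxx /=.
    by apply/forallP => p; rewrite labE implybb.
  rewrite /zeta smE supE addbK !eqxx /=.
  by apply/forallP => p; rewrite labE implybb.
case: (pickP (fun p => lab x p && ~~ lab z p)) => [p0 /andP[xp0 zp0]|eqs]; last first.
  apply: big_pred0 => y; apply/negbTE/negP => /and3P[_ Z1 Z2].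
  have [_ sz uz _ l] := zz y Z1 Z2; case/eqP: ne; apply: enhancedP => // p.
  by have := l p; have := eqs p; case: (lab x p); case: (lab y p); case: (lab z p).
pose K := same_circle (sm x) p0.
pose f y := enhance (sm y) (fun p => lab y p (+) K p) (sup y).
have fK : involutive f by move=> y; apply: enhancedP => // p; rewrite !labE addbK.
apply: (sum_toggle (b := fun y => lab y p0) fK) => y; last first.
  by rewrite labE /K same_circle_refl addbT.
case/and3P=> Cy Z1 Z2; have [sy sz uz uy l] := zz y Z1 Z2.
have inside p : K p -> lab x p && ~~ lab z p.
  move=> Kp; rewrite -(elimT (constantP x) Cx _ _ Kp) xp0.
  by rewrite -(elimT (constantP z) Cz p0 p) // sz.
apply/and3P; split.
- apply/constantP => p q; rewrite smE !labE => pq.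
  rewrite (elimT (constantP y) Cy _ _ pq); congr (_ (+) _).
  by rewrite /K ![same_circle _ p0 _]same_circle_sym -sy (same_circleE pq).
- rewrite /zeta smE supE sy uy !eqxx /=; apply/forallP => p; rewrite labE.
  by have := l p; case Kp: (K p); rewrite ?addbF; [have /andP[-> _] := inside _ Kp|];
    case: (lab y p) => //=; rewrite implybT.
- rewrite /zeta smE supE sz sy uz uy addbK !eqxx /=; apply/forallP => p; rewrite labE.
  have := l p; case Kp: (K p); rewrite ?addbF; last by case/andP.
  by have /andP[_ /negbTE ->] := inside _ Kp.
Qed.

Definition flip_at c x : enhanced D := (flip c (sm x), x.1.2, x.2).

Lemma sm_flip c x : sm (flip_at c x) = flip c (sm x).
Proof. by []. Qed.

Lemma lab_flip c x : lab (flip_at c x) = lab x.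
Proof. by []. Qed.

Lemma flip_atK c : involutive (flip_at c).
Proof. by case=> [[s l] u]; rewrite /flip_at /sm /= flipK. Qed.

Lemma flip_atC c c' x : flip_at c (flip_at c' x) = flip_at c' (flip_at c x).
Proof. by rewrite /flip_at /sm /= flipC. Qed.

Lemma cube_edgeP x y :
  reflect (exists2 c, ~~ sm x c & y = flip_at c x) (cube_edge x y).
Proof.
apply: (iffP and3P) => [[/existsP[c]]|[c xc ->]].
  rewrite edgeE => /andP[xc /eqP sy] /eqP ly /eqP uy; exists c => //.
  case: x y xc sy ly uy => [[s l] u] [[s' l'] u'] /= _.
  by rewrite /flip_at /sm /sup /= => -> -> ->.
split; [|exact: eqxx|exact: eqxx].
by apply/existsP; exists c; rewrite edgeE xc /=.
Qed.

(** The two ways around a face. The colours are constant on the circles of the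
    fourth vertex, since each of its resolutions occurs at [x] or at [z]. *)
Lemma cube_cube x z : constant_on_circles x -> constant_on_circles z ->
  (\sum_(y | constant_on_circles y) (cube_edge x y)%:R * (cube_edge y z)%:R = 0 :> 'F_2)%R.
Proof.
move=> Cx Cz; rewrite sum_mulb.
case: (pickP (fun c => sm x c != sm z c)) => [c0 ne0|eqs]; last first.
  apply: big1 => y /and3P[_ /cube_edgeP[c xc ->] /cube_edgeP[c' xc' E]].
  have := eqs c; rewrite E !sm_flip !flipE eqxx (negbTE xc) /=.
  have nc : c' != c by apply: contraNneq xc' => ->; rewrite sm_flip flipE eqxx (negbTE xc).
  by rewrite [c == c']eq_sym (negbTE nc).
pose f y : enhanced D := ([ffun c => sm x c (+) sm z c (+) sm y c], y.1.2, y.2).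
have fK : involutive f.
  case=> [[s l] u]; rewrite /f /sm /=; congr (_, _, _).
  by apply/ffunP => c; rewrite !ffunE addKb.
apply: (sum_toggle (b := fun y => sm y c0) fK) => y; last first.
  move=> _; rewrite {1}/f {1}/sm /= ffunE; move: ne0.
  by case: (sm x c0); case: (sm z c0); case: (sm y c0).
case/and3P=> [Cy /cube_edgeP[c xc yE] /cube_edgeP[c' yc' zE]].
have ne : c' != c by apply: contraNneq yc' => ->; rewrite yE sm_flip flipE eqxx (negbTE xc).
have fE : f y = flip_at c' x.
  rewrite /f zE yE /flip_at /sm /=; congr (_, _, _); apply/ffunP => e; rewrite !ffunE.
  by case: (e == c); case: (e == c'); case: (x.1.1 e).
have xc' : ~~ sm x c' by move: yc'; rewrite yE sm_flip flipE (negbTE ne).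
have lyx : lab y = lab x by rewrite yE.
have lzx : lab z = lab x by rewrite zE yE.
apply/and3P; split.
- move: Cx Cy Cz; rewrite !constant_on_circlesE lyx lzx fE.
  case/andP=> T /forallP Kx /andP[_ /forallP Ky] /andP[_ /forallP Kz].
  rewrite ?lab_flip T; apply/forallP => e; rewrite ?lab_flip /vertical sm_flip flipE.
  have := Kx e; have := Kz e; rewrite /vertical zE yE !sm_flip !flipE.
  by have [->|_ _] /= := eqVneq e c'; first by rewrite (negbTE ne).
- by apply/cube_edgeP; exists c'.
- apply/cube_edgeP; exists c; rewrite fE.
    by rewrite sm_flip flipE eq_sym (negbTE ne) xc.
  by rewrite zE yE flip_atC.
Qed.

(** Both resolutions are compatible only if all four corners have one colour. *)
Definition mono (l : point D -> bool) c : bool := compatible l c true && compatible l c false.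

Definition proper x : bool := [forall c, ~~ mono (lab x) c].

Lemma constant_flip c x : constant_on_circles x ->
  constant_on_circles (flip_at c x) = mono (lab x) c.
Proof.
rewrite !constant_on_circlesE => /andP[T /forallP H].
rewrite /flip_at {1}/lab {1}/sm /= -/(lab x) T /mono.
have := H c; rewrite /vertical => Hc; apply/forallP/idP => [/(_ c)|/andP[H1 H2] e].
  rewrite flipE eqxx; move: Hc; rewrite /lab /=.
  by case: (sw_over c); case: (sm x c) => /= -> ->.
have := H e; rewrite /vertical flipE /lab /=.
have [-> _|_ //] := eqVneq e c.
by move: H1 H2; rewrite /lab; case: (_ != _).
Qed.

(** The inverse of the edges in one direction of the cube. The direction depends
    on the colours alone, which the differential keeps. *)
Definition contraction x y : bool :=
  if [pick c | mono (lab x) c] is Some c then sm x c && (y == flip_at c x) else false.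

(** Changing the resolution at the chosen crossing [c0] commutes with changing the
    resolution elsewhere, so those terms cancel; back and forth at [c0] itself
    gives the identity. *)
Lemma contraction_homotopy x z : constant_on_circles x -> constant_on_circles z ->
  (\sum_(y | constant_on_circles y) (cube_edge x y)%:R * (contraction y z)%:R +
   \sum_(y | constant_on_circles y) (contraction x y)%:R * (cube_edge y z)%:R =
   (x == z)%:R + ((x == z) && proper x)%:R :> 'F_2)%R.
Proof.
move=> Cx Cz; rewrite !sum_mulb.
have ctrE y : lab y = lab x -> contraction y =1 (fun y' =>
    if [pick c | mono (lab x) c] is Some c then sm y c && (y' == flip_at c y) else false).
  by move=> E y'; rewrite /contraction E.
have labz y : cube_edge x y -> lab y = lab x by case/cube_edgeP => c _ ->.
case: pickP ctrE => [c0 m0|nm] ctrE; last first.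
  have -> : proper x by apply/forallP => c; rewrite nm.
  rewrite andbT addrr_F2 !big_pred0 ?addr0 // => y; first by rewrite ctrE // andbF.
  by apply/negbTE/negP => /and3P[_ /labz ly]; rewrite ctrE.
have -> : proper x = false by apply/negbTE/forallPn; exists c0; rewrite m0.
rewrite andbF addr0.
have one y0 B : (\sum_(y : enhanced D | (y == y0) && B) 1 = B%:R :> 'F_2)%R.
  case: B; last by rewrite big_pred0 // => y; rewrite andbF.
  by rewrite (eq_bigl (pred1 y0)) ?big_pred1_eq // => y; rewrite andbT.
rewrite (eq_bigl (fun y => (y == flip_at c0 z)
                        && (~~ sm z c0 && cube_edge x (flip_at c0 z)))); last first.
  move=> y; apply/and3P/and3P => [[Cy xy]|[/eqP-> z0 xy]].
    rewrite ctrE ?labz // => /andP[y0 /eqP ->].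
    by rewrite flip_atK sm_flip flipE !eqxx y0 xy.
  have lz := labz _ xy; rewrite lab_flip in lz.
  by rewrite constant_flip // lz m0 xy ctrE // flip_atK sm_flip flipE !eqxx /= z0.
rewrite [X in (_ + X)%R](eq_bigl (fun y => (y == flip_at c0 x)
                        && (sm x c0 && cube_edge (flip_at c0 x) z))); last first.
  move=> y; rewrite ctrE //; apply/and3P/and3P => [[_ /andP[x0 /eqP ->]] xz|[/eqP-> x0 xz]].
    by rewrite eqxx x0 xz.
  by rewrite constant_flip // m0 x0 eqxx xz.
rewrite !one.
have [<-|ne] := eqVneq x z.
  have -> : cube_edge (flip_at c0 x) x = sm x c0.
    apply/cube_edgeP/idP => [[c]|x0].
      rewrite sm_flip flipE => /[swap]; rewrite -{1}[x](flip_atK c0) => /(congr1 (@sm D)).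
      rewrite !sm_flip => /flip_inj <-; rewrite eqxx /=; by rewrite negbK.
    by exists c0; rewrite ?flip_atK // sm_flip flipE eqxx /= x0.
  have [x0|x0] /= := boolP (sm x c0); first by rewrite add0r.
  rewrite addr0 (_ : cube_edge _ _) //; apply/cube_edgeP; by exists c0.
suff -> : ~~ sm z c0 && cube_edge x (flip_at c0 z) = sm x c0 && cube_edge (flip_at c0 x) z.
  exact: addrr_F2.
apply/andP/andP => [] [e0 /cube_edgeP[c xc E]].
  have {E}zE : z = flip_at c (flip_at c0 x) by rewrite flip_atC -E flip_atK.
  have nc : c != c0 by apply: contraNneq ne => c_c0; rewrite zE c_c0 flip_atK.
  split; first by move: e0; rewrite zE !sm_flip !flipE eqxx eq_sym (negbTE nc) /= negbK.
  by apply/cube_edgeP; exists c => //; rewrite sm_flip flipE (negbTE nc).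
have nc : c != c0 by apply: contraNneq ne => c_c0; rewrite E c_c0 flip_atK.
split; first by rewrite E !sm_flip !flipE eqxx eq_sym (negbTE nc) e0.
apply/cube_edgeP; exists c; last by rewrite E flip_atC flip_atK.
by move: xc; rewrite sm_flip flipE (negbTE nc).
Qed.

End Cube.

Local Open Scope ring_scope.

(** * Chain maps as homogeneous matrices *)

(** All degrees are put together in one matrix, which avoids transports between
    the types of chains in different degrees. *)
Definition basis (D : diagram) : finType := {x : enhanced D | constant_on_circles x}.

Definition bval (D : diagram) (a : 'I_#|basis D|) : enhanced D := val (enum_val a).

Lemma bvalP D (a : 'I_#|basis D|) : constant_on_circles (bval a).
Proof. exact: valP. Qed.

Lemma bval_inj D : injective (@bval D).
Proof. by move=> a b /val_inj/enum_val_inj. Qed.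

Definition kernel_mx (D D' : diagram) (K : enhanced D -> enhanced D' -> bool) :
    'M['F_2]_(#|basis D|, #|basis D'|) :=
  \matrix_(a, b) (K (bval a) (bval b))%:R.

Lemma sum_bval D (F : enhanced D -> 'F_2) :
  \sum_a F (bval a) = \sum_(x | constant_on_circles x) F x.
Proof.
transitivity (\sum_(g : basis D) F (val g)).
  by rewrite [RHS](reindex_onto enum_val enum_rank) => [|g _]; rewrite ?enum_rankK //=;
    apply: eq_bigl => a; rewrite enum_valK eqxx.
rewrite -(big_imset F (h := val) (A := predT)) /=; last by move=> g h _ _ /val_inj.
apply: eq_bigl => x; apply/imsetP/idP => [[g _ ->]|Cx]; first exact: valP.
by exists (exist _ x Cx).
Qed.

Lemma kernel_mxM D D' D'' (K : enhanced D -> enhanced D' -> bool)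
    (L : enhanced D' -> enhanced D'' -> bool) a b :
  (kernel_mx K *m kernel_mx L) a b =
  \sum_(y | constant_on_circles y) (K (bval a) y)%:R * (L y (bval b))%:R.
Proof. by rewrite mxE -sum_bval; apply: eq_bigr => j _; rewrite !mxE. Qed.

Definition hgt D (a : 'I_#|basis D|) : int := height (sm (bval a)).

Definition homogeneous D D' (k : int) (M : 'M['F_2]_(#|basis D|, #|basis D'|)) : Prop :=
  forall a b, M a b != 0 -> hgt b = hgt a + k.

Lemma homogeneous_mul D D' D'' k l (M : 'M_(#|basis D|, #|basis D'|))
    (N : 'M_(#|basis D'|, #|basis D''|)) :
  homogeneous k M -> homogeneous l N -> homogeneous (k + l) (M *m N).
Proof.
move=> Mk Nl a b; rewrite mxE => nz.
have [j] : exists j, M a j * N j b != 0.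
  apply/existsP; apply: contraNT nz => /existsPn H; apply/eqP/big1 => j _.
  by apply/eqP; have := H j; rewrite negbK.
rewrite mulf_eq0 negb_or => /andP[/Mk Ej /Nl ->].
by rewrite Ej addrA.
Qed.

Lemma homogeneous_kernel_mx D D' k (K : enhanced D -> enhanced D' -> bool) :
    (forall x y, K x y -> height (sm y) = height (sm x) + k) ->
  homogeneous k (kernel_mx K).
Proof.
move=> H a b; rewrite mxE; case E: (K _ _); last by rewrite eqxx.
by move=> _; exact: H.
Qed.

Definition pick_basis D i (g : generator D i) : basis D :=
  exist _ (val g) (proj1 (andP (valP g))).

Definition rank D i (g : generator D i) : 'I_#|basis D| := enum_rank (pick_basis g).

Lemma bval_rank D i (g : generator D i) : bval (rank g) = val g.
Proof. by rewrite /bval enum_rankK. Qed.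

Lemma hgt_rank D i (g : generator D i) : hgt (rank g) = i.
Proof. by rewrite /hgt bval_rank; case/andP: (valP g) => _ /eqP. Qed.

Lemma rank_surj D (a : 'I_#|basis D|) : exists g : generator D (hgt a), rank g = a.
Proof.
have H : constant_on_circles (bval a) && (height (sm (bval a)) == hgt a).
  by rewrite bvalP eqxx.
by exists (Sub (bval a) H : generator D (hgt a)); apply: bval_inj; rewrite bval_rank SubK.
Qed.

Lemma rank_inj D i : injective (@rank D i).
Proof. by move=> g h /(congr1 (@bval D)); rewrite !bval_rank => /val_inj. Qed.

Lemma sum_rank D i (F : 'I_#|basis D| -> 'F_2) :
  \sum_(g : generator D i) F (rank g) = \sum_(a | hgt a == i) F a.
Proof.
rewrite -(big_imset F (h := @rank D i) (A := predT)) /=; last by move=> g h _ _ /rank_inj.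
apply: eq_bigl => a; apply/imsetP/eqP => [[g _ ->]|<-]; first exact: hgt_rank.
by have [g ga] := rank_surj a; exists g.
Qed.

Section Operators.

Variables D D' : diagram.
Implicit Type M : 'M['F_2]_(#|basis D|, #|basis D'|).

Definition graded_op M (i j : int) (x : chain D i) : chain D' j :=
  [ffun y => \sum_(g : generator D i) M (rank g) (rank y) * x g].

Lemma graded_op_is_linear M i j : linear (@graded_op M i j).
Proof.
move=> a x y; apply/ffunP => z; rewrite !ffunE /= scaler_sumr -big_split /=.
apply: eq_bigr => g _; rewrite !ffunE mulrDr; congr (_ + _).
by rewrite [LHS]mulrCA.
Qed.

HB.instance Definition _ M i j :=
  GRing.isLinear.Build 'F_2 (chain D i) (chain D' j) _
    (@graded_op M i j) (@graded_op_is_linear M i j).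

Lemma graded_opD M N i j (x : chain D i) :
  graded_op (M + N) j x = graded_op M j x + graded_op N j x.
Proof.
by apply/ffunP => y; rewrite !ffunE -big_split; apply: eq_bigr => g _; rewrite mxE mulrDl.
Qed.

End Operators.

Lemma graded_op_id D i (x : chain D i) : graded_op 1%:M i x = x.
Proof.
apply/ffunP => y; rewrite ffunE (bigD1 y) //= mxE eqxx mul1r big1 ?addr0 // => g ne.
by rewrite mxE (inj_eq (@rank_inj D i)) (negbTE ne) mul0r.
Qed.

(** Terms in degrees other than [j] vanish because [M] is homogeneous. *)
Lemma graded_op_comp D D' D'' (M : 'M_(#|basis D|, #|basis D'|))
    (N : 'M_(#|basis D'|, #|basis D''|)) k i j l (x : chain D i) :
  homogeneous k M -> j = i + k -> graded_op N l (graded_op M j x) = graded_op (M *m N) l x.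
Proof.
move=> Mk ->; apply/ffunP => z; rewrite !ffunE.
under eq_bigr => g _ do rewrite ffunE mulr_sumr.
rewrite exchange_big; apply: eq_bigr => h _ /=.
rewrite mxE mulr_suml.
transitivity (\sum_(g : generator D' (i + k)) M (rank h) (rank g) * N (rank g) (rank z) * x h).
  by apply: eq_bigr => g _; rewrite mulrA [X in X * _]mulrC.
rewrite (sum_rank _ (fun a => M (rank h) a * N a (rank z) * x h)).
rewrite big_mkcond /=; apply: eq_bigr => a _; case: eqP => // ne.
have [->|/Mk] := eqVneq (M (rank h) a) 0; first by rewrite !mul0r.
by rewrite hgt_rank => /ne.
Qed.

(** * Comparison of two diagrams *)

Local Notation incident_mx D := (kernel_mx (@incident D)).
Local Notation zeta_mx D := (kernel_mx (@zeta D)).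
Local Notation cube_mx D := (kernel_mx (@cube_edge D)).
Local Notation contraction_mx D := (kernel_mx (@contraction D)).

Lemma height_edge D c (s s' : smoothing D) : edge c s s' -> height s' = height s + 1.
Proof.
by move/ones_edge; rewrite /height /ones => ->; rewrite -addn1 PoszD addrAC.
Qed.

Lemma incident_homogeneous D : homogeneous 1 (incident_mx D).
Proof.
apply: homogeneous_kernel_mx => x y /existsP[c /and3P[e _ _]]; exact: height_edge e.
Qed.

Lemma zeta_homogeneous D : homogeneous 0 (zeta_mx D).
Proof. by apply: homogeneous_kernel_mx => x y /and3P[/eqP -> _ _]; rewrite addr0. Qed.

Lemma contraction_homogeneous D : homogeneous (-1) (contraction_mx D).
Proof.
apply: homogeneous_kernel_mx => x y; rewrite /contraction; case: pickP => // c _ /andP[xc /eqP->].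
have e : edge c (flip c (sm x)) (sm x) by rewrite edgeE flipK flipE !eqxx xc.
by rewrite sm_flip (height_edge e) addrK.
Qed.

Lemma zeta_mxK D : zeta_mx D *m zeta_mx D = 1%:M.
Proof.
apply/matrixP => a b; rewrite kernel_mxM zeta_zeta ?bvalP // mxE.
by rewrite (inj_eq (@bval_inj D)).
Qed.

Lemma incident_zeta_mx D :
  incident_mx D *m zeta_mx D = zeta_mx D *m cube_mx D.
Proof. by apply/matrixP => a b; rewrite !kernel_mxM incident_zeta ?bvalP. Qed.

Lemma cube_cube_mx D : cube_mx D *m cube_mx D = 0.
Proof. by apply/matrixP => a b; rewrite kernel_mxM cube_cube ?bvalP // mxE. Qed.

Definition proper_mx D := kernel_mx (fun x y : enhanced D => (x == y) && proper x).

Lemma contraction_homotopy_mx D :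
  cube_mx D *m contraction_mx D + contraction_mx D *m cube_mx D
    = 1%:M + proper_mx D.
Proof.
apply/matrixP => a b; rewrite mxE !kernel_mxM contraction_homotopy ?bvalP // !mxE.
by rewrite (inj_eq (@bval_inj D)).
Qed.

Lemma cube_edge_mono D (x y : enhanced D) :
    constant_on_circles x -> constant_on_circles y -> cube_edge x y ->
  proper x = false /\ proper y = false.
Proof.
move=> Cx Cy /cube_edgeP[c xc yE]; rewrite yE constant_flip // in Cy.
by rewrite yE; split; apply/negbTE/forallPn; exists c; rewrite negbK.
Qed.

Definition proper_at D (i : int) : {set enhanced D} :=
  [set x | [&& constant_on_circles x, proper x & height (sm x) == i]].

(** The rank among the proper colourings of the same degree, used to match the
    proper colourings of two diagrams. *)
Definition place D (x : enhanced D) : nat := index x (enum (proper_at D (height (sm x)))).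

Definition matching D D' (x : enhanced D) (y : enhanced D') : bool :=
  [&& proper x, proper y, height (sm x) == height (sm y) & place x == place y].

Local Notation matching_mx D D' := (kernel_mx (@matching D D')).

Lemma matchingC D D' (x : enhanced D) (y : enhanced D') : matching x y = matching y x.
Proof.
by rewrite /matching andbCA [height _ == _]eq_sym [place _ == _]eq_sym.
Qed.

Lemma matching_inj D D' (x z : enhanced D) (y : enhanced D') :
    constant_on_circles x -> constant_on_circles z ->
  matching x y -> matching z y -> x = z.
Proof.
move=> Cx Cz /and4P[px _ /eqP hx /eqP ix] /and4P[pz _ /eqP hz /eqP iz].
have xin : x \in enum (proper_at D (height (sm x))) by rewrite mem_enum inE Cx px eqxx.
have zin : z \in enum (proper_at D (height (sm x))).
  by rewrite mem_enum inE Cz pz hx hz eqxx.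
rewrite -(nth_index x xin) -(nth_index x zin); congr nth.
by rewrite -/(place x) ix -iz /place hx hz.
Qed.

Lemma matching_exists D D' (x : enhanced D) :
    (forall i, #|proper_at D i| = #|proper_at D' i|) ->
    constant_on_circles x -> proper x ->
  exists2 y : enhanced D', constant_on_circles y & matching x y.
Proof.
move=> cards Cx px; pose i := height (sm x).
have xin : x \in enum (proper_at D i) by rewrite mem_enum inE Cx px eqxx.
have lt : (place x < size (enum (proper_at D' i)))%N by rewrite -cardE -cards cardE index_mem.
have [y0 _] : exists y0, y0 \in enum (proper_at D' i).
  by case: (enum _) lt => // y0 s _; exists y0; rewrite inE eqxx.
have yin := mem_nth y0 lt; move: (yin); rewrite mem_enum inE => /and3P[Cy py /eqP hy].
exists (nth y0 (enum (proper_at D' i)) (place x)) => //.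
by rewrite /matching px py hy eqxx /= /place hy index_uniq ?enum_uniq.
Qed.

Lemma matching_mxK D D' :
    (forall i, #|proper_at D i| = #|proper_at D' i|) ->
  matching_mx D D' *m matching_mx D' D = proper_mx D.
Proof.
move=> cards; apply/matrixP => a b; rewrite kernel_mxM mxE sum_mulb.
have [px|npx] := boolP (proper (bval a)); last first.
  by rewrite andbF big_pred0 // => y; rewrite /matching (negbTE npx) andbF.
have [y Cy xy] := matching_exists cards (bvalP a) px.
rewrite andbT; case: eqVneq => [<-|ne].
  rewrite (eq_bigl (pred1 y)) ?big_pred1_eq // => z /=; apply/and3P/eqP => [[Cz xz _]|->].
    by apply: (matching_inj (y := bval a)) => //; rewrite matchingC.
  by rewrite Cy xy matchingC xy.
rewrite big_pred0 // => z; apply/negbTE/negP => /and3P[_ xz zb].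
rewrite matchingC in zb; case/eqP: ne.
exact: (matching_inj (bvalP a) (bvalP b) xz zb).
Qed.

Lemma cube_matching_mx D D' : cube_mx D *m matching_mx D D' = 0.
Proof.
apply/matrixP => a b; rewrite kernel_mxM mxE sum_mulb big_pred0 // => y.
apply/negbTE/negP => /and3P[Cy E /and4P[py _ _ _]].
by have [_] := cube_edge_mono (bvalP a) Cy E; rewrite py.
Qed.

Lemma matching_cube_mx D D' : matching_mx D D' *m cube_mx D' = 0.
Proof.
apply/matrixP => a b; rewrite kernel_mxM mxE sum_mulb big_pred0 // => y.
apply/negbTE/negP => /and3P[Cy /and4P[_ py _ _] E].
by have [] := cube_edge_mono Cy (bvalP b) E; rewrite py.
Qed.

Lemma matching_homogeneous D D' : homogeneous 0 (matching_mx D D').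
Proof. by apply: homogeneous_kernel_mx => x y /and4P[_ _ /eqP -> _]; rewrite addr0. Qed.

Lemma diff_graded_op D i (x : chain D i) :
  d (CDBN D) i x = graded_op (incident_mx D) (i + 1) x.
Proof.
apply/ffunP => y; rewrite !ffunE; apply: eq_bigr => g _.
by rewrite mxE !bval_rank.
Qed.

(** As [zeta] is an involution, it conjugates the two differentials into each
    other. *)
Lemma zeta_incident_mx D :
  zeta_mx D *m incident_mx D = cube_mx D *m zeta_mx D.
Proof.
rewrite -[LHS]mulmx1 -(zeta_mxK D) -[LHS]mulmxA [X in _ *m X]mulmxA incident_zeta_mx.
by rewrite -[X in _ *m X]mulmxA mulmxA mulmxA zeta_mxK mul1mx.
Qed.

Lemma incident_incident_mx D : incident_mx D *m incident_mx D = 0.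
Proof.
rewrite -[LHS]mulmx1 -(zeta_mxK D) mulmxA -[X in X *m _]mulmxA incident_zeta_mx.
by rewrite mulmxA incident_zeta_mx -mulmxA -mulmxA [X in _ *m X]mulmxA cube_cube_mx mul0mx mulmx0.
Qed.

Lemma CDBN_is_complex D : is_complex (CDBN D).
Proof.
move=> i x; rewrite !diff_graded_op (graded_op_comp _ _ _ (@incident_homogeneous D) erefl).
rewrite incident_incident_mx; apply/ffunP => y; rewrite !ffunE big1 // => g _.
by rewrite mxE mul0r.
Qed.

(** Project onto the proper colourings, match them with those of the other
    diagram, and return to labels. *)
Definition comparison D D' := zeta_mx D *m matching_mx D D' *m zeta_mx D'.

Lemma comparison_homogeneous D D' : homogeneous 0 (comparison D D').
Proof.
rewrite -[0]/(0 + 0 + 0 : int); apply: homogeneous_mul (@zeta_homogeneous D').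
exact: homogeneous_mul (@zeta_homogeneous D) (@matching_homogeneous D D').
Qed.

(** Both sides vanish: proper colourings have no edges. *)
Lemma comparison_chain_map D D' :
  incident_mx D *m comparison D D' = comparison D D' *m incident_mx D'.
Proof.
transitivity (0 : 'M['F_2]_(#|basis D|, #|basis D'|)).
  rewrite /comparison !mulmxA incident_zeta_mx -[X in X *m _]mulmxA cube_matching_mx.
  by rewrite mulmx0 mul0mx.
rewrite /comparison -mulmxA zeta_incident_mx mulmxA -[X in X *m _]mulmxA matching_cube_mx.
by rewrite mulmx0 mul0mx.
Qed.

Definition homotopy_mx D := zeta_mx D *m contraction_mx D *m zeta_mx D.

Lemma homotopy_homogeneous D : homogeneous (-1) (homotopy_mx D).
Proof.
rewrite -[-1]/(0 + -1 + 0 : int); apply: homogeneous_mul (@zeta_homogeneous D).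
exact: homogeneous_mul (@zeta_homogeneous D) (@contraction_homogeneous D).
Qed.

Lemma comparison_homotopy D D' :
    (forall i, #|proper_at D i| = #|proper_at D' i|) ->
  comparison D D' *m comparison D' D + 1%:M =
    homotopy_mx D *m incident_mx D + incident_mx D *m homotopy_mx D.
Proof.
move=> cards; rewrite /comparison /homotopy_mx.
have -> : zeta_mx D *m matching_mx D D' *m zeta_mx D' *m
   (zeta_mx D' *m matching_mx D' D *m zeta_mx D) =
   zeta_mx D *m proper_mx D *m zeta_mx D.
  by rewrite !mulmxA -[_ *m zeta_mx D' *m zeta_mx D']mulmxA zeta_mxK mulmx1
     -[_ *m matching_mx D D' *m matching_mx D' D]mulmxA matching_mxK.
have -> : 1%:M = zeta_mx D *m 1%:M *m zeta_mx D by rewrite mulmx1 zeta_mxK.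
rewrite -mulmxDl -mulmxDr addrC -contraction_homotopy_mx mulmxDr mulmxDl addrC.
by rewrite -!mulmxA zeta_incident_mx !mulmxA incident_zeta_mx.
Qed.

Lemma oppr_F2 (V : lmodType 'F_2) (v : V) : - v = v.
Proof.
by rewrite -scaleN1r (_ : -1 = 1 :> 'F_2) ?scale1r //; apply/eqP.
Qed.

Lemma CDBN_homotopy_equivalent D D' :
  (forall i, #|proper_at D i| = #|proper_at D' i|) ->
  homotopy_equivalent (CDBN D) (CDBN D').
Proof.
move=> cards.
have half E E' : (forall i, #|proper_at E i| = #|proper_at E' i|) ->
    is_chain_map (B := CDBN E) (C := CDBN E')
      (fun i => graded_op (comparison E E') i : {linear chain E i -> chain E' i}) /\
    homotopic (B := CDBN E) (C := CDBN E)
      (fun i x => graded_op (comparison E' E) i (graded_op (comparison E E') i x)) (fun _ x => x).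
  move=> {}cards; split=> [i x|].
    rewrite !diff_graded_op /= (graded_op_comp _ _ _ (@incident_homogeneous E) erefl).
    rewrite (graded_op_comp _ _ _ (@comparison_homogeneous E E')) ?addr0 //.
    by rewrite comparison_chain_map.
  exists (fun i => graded_op (homotopy_mx E) i : {linear chain E (i + 1) -> chain E i}).
  move=> i x; rewrite !diff_graded_op /=.
  rewrite (graded_op_comp _ _ _ (@comparison_homogeneous E E')) ?addr0 //.
  rewrite (graded_op_comp _ _ _ (@homotopy_homogeneous E)) ?addrK //.
  rewrite (graded_op_comp _ _ _ (@incident_homogeneous E) erefl) -graded_opD.
  rewrite -(comparison_homotopy cards) graded_opD graded_op_id; congr (_ + _); exact: oppr_F2.
have [cm hD] := half D D' cards.
have [cm' hD'] := half D' D (fun i => esym (cards i)).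
by do 2 eexists; split; [exact: cm|exact: cm'|exact: hD|exact: hD'].
Qed.

Local Close Scope ring_scope.

(** * Transfer operators *)

(** The colours above a piece, given the colours [e] below it, in a proper
    colouring. At a crossing, vertical arcs give x, y with x <> y, and horizontal
    arcs take x, x to ~x, ~x; both are the exchange of x, y into ~y, ~x. *)
Definition after (e : seq bool) (a : slice) : seq (seq bool) :=
  let: (i, g) := a in
  let insert m := take i e ++ m ++ drop (i + nin g) e in
  match g with
  | Cup _ => [:: insert [:: true; true]; insert [:: false; false]]
  | Cap => if nth false e i == nth false e i.+1 then [:: insert [::]] else [::]
  | Cross _ => [:: insert [:: ~~ nth false e i.+1; ~~ nth false e i]]
  end.

(** 1 when the colours force a 1-resolution. *)
Definition weight (e : seq bool) (a : slice) : nat :=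
  if a.2 is Cross b then b != (nth false e a.1 != nth false e a.1.+1) else 0.

(** 1 when the directions make the crossing negative. *)
Definition negative (e : seq bool) (a : slice) : nat :=
  if a.2 is Cross b then b != (nth false e a.1 == nth false e a.1.+1) else 0.

Fixpoint negatives (e : seq bool) (w : seq slice) : nat :=
  if w is a :: w' then negative e a + negatives (act e a) w' else 0.

Lemma negatives_cat e w w' :
  negatives e (w ++ w') = negatives e w + negatives (foldl act e w) w'.
Proof. by elim: w e => //= a w IH e; rewrite IH addnA. Qed.

Lemma valid_cat e w w' : valid e (w ++ w') = valid e w && valid (foldl act e w) w'.
Proof. by elim: w e => //= a w IH e; rewrite IH andbA. Qed.

(** A piece acts on the strands that enter it, whatever stands left and right. *)
Section LocalForms.

Variables (pre m post : seq bool) (g : piece).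
Hypothesis size_m : size m = nin g.

Let take_pre : take (size pre) (pre ++ m ++ post) = pre.
Proof. by rewrite take_size_cat. Qed.

Let drop_pre : drop (size pre + nin g) (pre ++ m ++ post) = post.
Proof. by rewrite catA drop_size_cat // size_cat size_m. Qed.

Let nth_pre k : k < nin g ->
  nth false (pre ++ m ++ post) (size pre + k) = nth false m k.
Proof. by move=> lt; rewrite nth_cat ltnNge leq_addr /= addKn nth_cat size_m lt. Qed.

Lemma after_local : after (pre ++ m ++ post) (size pre, g) =
  [seq pre ++ x ++ post | x <- after m (0, g)].
Proof.
have n0 : 1 < nin g -> nth false (pre ++ m ++ post) (size pre) = nth false m 0.
  by move=> lt; rewrite -nth_pre ?addn0 //; lia.
have n1 : 1 < nin g -> nth false (pre ++ m ++ post) (size pre).+1 = nth false m 1.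
  by move=> lt; rewrite -nth_pre ?addn1.
rewrite /after take_pre drop_pre add0n take0 -size_m drop_size.
by case: g n0 n1 => [o||b] /= n0 n1; rewrite ?n0 ?n1 ?cats0 //; case: ifP.
Qed.

Lemma weight_local : weight (pre ++ m ++ post) (size pre, g) = weight m (0, g).
Proof.
rewrite /weight /=; case: g nth_pre => //= b H.
by rewrite -(H 0) // -(H 1) // addn0 addn1.
Qed.

Lemma negative_local : negative (pre ++ m ++ post) (size pre, g) = negative m (0, g).
Proof.
rewrite /negative /=; case: g nth_pre => //= b H.
by rewrite -(H 0) // -(H 1) // addn0 addn1.
Qed.

Lemma act_local : act (pre ++ m ++ post) (size pre, g) = pre ++ act m (0, g) ++ post.
Proof.
rewrite /act take_pre drop_pre add0n take0 -size_m drop_size cats0.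
case: g nth_pre => //= b H.
by rewrite -(H 0) // -(H 1) // addn0 addn1.
Qed.

Lemma admissible_local :
  admissible (pre ++ m ++ post) (size pre, g) = admissible m (0, g).
Proof.
rewrite /admissible !size_cat size_m add0n leqnn leq_add2l leq_addr /=.
case: g nth_pre => //= H.
by rewrite -(H 0) // -(H 1) // addn0 addn1.
Qed.

End LocalForms.

Lemma local_split (e : seq bool) i g : i + nin g <= size e ->
  exists pre m post, [/\ e = pre ++ m ++ post, size pre = i & size m = nin g].
Proof.
move=> H; exists (take i e), (take (nin g) (drop i e)), (drop (nin g) (drop i e)).
by rewrite !cat_take_drop !size_takel // ?size_drop; lia.
Qed.

Lemma size_after e i g e' : i + nin g <= size e -> e' \in after e (i, g) ->
  size e' + nin g = size e + nout g.
Proof.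
move=> H; rewrite /after.
have tk : size (take i e) = i by rewrite size_takel //; lia.
case: g H => [o||b] /= H.
- by rewrite !inE => /orP[] /eqP ->; rewrite size_cat /= tk size_drop; lia.
- by case: ifP => // _; rewrite inE => /eqP ->; rewrite size_cat /= tk size_drop; lia.
- by rewrite inE => /eqP ->; rewrite size_cat /= tk size_drop; lia.
Qed.

Local Open Scope ring_scope.

Section Transfer.

Variables (R : comNzRingType) (q : R).
Implicit Types (phi psi : seq bool -> R) (w : seq slice) (e : seq bool).

(** Transfer operators act on functions of the colours above and yield functions
    of the colours below, so that a word is applied from its right end. *)
Definition step (a : slice) phi : seq bool -> R :=
  fun e => q ^+ weight e a * \sum_(e' <- after e a) phi e'.

Definition transfer w phi : seq bool -> R := foldr step phi w.

Lemma transfer_cons a w phi e : transfer (a :: w) phi e =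
  q ^+ weight e a * \sum_(e' <- after e a) transfer w phi e'.
Proof. by []. Qed.

Definition delta (m : seq bool) : seq bool -> R := fun e => (e == m)%:R.

Lemma transfer_cat w w' phi : transfer (w ++ w') phi = transfer w (transfer w' phi).
Proof. exact: foldr_cat. Qed.

Lemma size_after_act e0 e a e' : admissible e0 a -> size e = size e0 -> e' \in after e a ->
  size e' = size (act e0 a).
Proof.
case: a => i g /andP[H _] E e'a; have := @size_after e i g e' _ e'a.
by rewrite E => /(_ H) E'; apply: (@addIn (nin g)); rewrite E' size_act.
Qed.

(** Only the levels with the right number of points matter. *)
Lemma transfer_ext e0 w phi psi : valid e0 w ->
    (forall e, size e = size (foldl act e0 w) -> phi e = psi e) ->
  forall e, size e = size e0 -> transfer w phi e = transfer w psi e.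
Proof.
elim: w e0 => [|a w IH] e0 => [_ H e /H //|/andP[adm val] H e se].
rewrite !transfer_cons; congr (_ * _); apply: eq_big_seq => e' e'a.
by apply: (IH _ val H); apply: size_after_act e'a.
Qed.

Lemma transfer_sum (I : finType) w (F : I -> seq bool -> R) (c : I -> R) e :
  transfer w (fun x => \sum_i F i x * c i) e = \sum_i transfer w (F i) e * c i.
Proof.
elim: w e => // a w IH e; rewrite transfer_cons.
under eq_bigr => e' _ do rewrite IH.
rewrite exchange_big mulr_sumr; apply: eq_bigr => i _.
by rewrite transfer_cons -mulr_suml mulrA.
Qed.

Lemma transferZ w c phi e : transfer w (fun x => c * phi x) e = c * transfer w phi e.
Proof.
elim: w e => // a w IH e; rewrite transfer_cons.
under eq_bigr => e' _ do rewrite IH.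
by rewrite -mulr_sumr mulrCA.
Qed.

Definition level_sum n (F : seq bool -> R) : R := \sum_(e : n.-tuple bool) F e.

Lemma eq_level_sum n F G : (forall e, size e = n -> F e = G e) ->
  level_sum n F = level_sum n G.
Proof. by move=> E; apply: eq_bigr => e _; rewrite E ?size_tuple. Qed.

Lemma level_sum_rev n F : level_sum n F = level_sum n (fun e => F (rev e)).
Proof.
rewrite /level_sum (reindex_inj (h := fun e : n.-tuple bool => [tuple of rev e])) //.
by move=> e e' /(congr1 val) /= /(can_inj revK) /val_inj.
Qed.

Lemma level_sum_cons n F :
  level_sum n.+1 F = \sum_(a : bool) level_sum n (fun e => F (a :: e)).
Proof.
rewrite /level_sum pair_big /=.
rewrite (reindex (fun p : bool * n.-tuple bool => [tuple of p.1 :: p.2])) //=.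
exists (fun t => (thead t, [tuple of behead t])) => [[a e] _|t _] /=.
  by congr (_, _); apply: val_inj.
by apply: val_inj; rewrite /= [in RHS](tuple_eta t).
Qed.

Lemma level_sum_rcons n F :
  level_sum n.+1 F = \sum_(a : bool) level_sum n (fun e => F (rcons e a)).
Proof.
rewrite level_sum_rev level_sum_cons; apply: eq_bigr => a _.
by rewrite level_sum_rev; apply: eq_bigr => e _; rewrite rev_cons revK.
Qed.

(** The matrix coefficients of an operator are its values at the delta functions. *)
Lemma transfer_expand e0 w phi e : valid e0 w -> size e = size e0 ->
  transfer w phi e =
  level_sum (size (foldl act e0 w)) (fun m => transfer w (delta m) e * phi m).
Proof.
move=> val se; pose T := (size (foldl act e0 w)).-tuple bool.
rewrite /level_sum -(transfer_sum w (fun m : T => delta m) (fun m => phi m)).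
apply: transfer_ext val _ _ se => x sx.
pose t : (size (foldl act e0 w)).-tuple bool := tcast sx (in_tuple x).
have tE : tval t = x by rewrite val_tcast.
rewrite (bigD1 t) //= tE /delta eqxx mul1r big1 ?addr0 // => m ne.
by rewrite -tE (inj_eq val_inj) eq_sym (negbTE ne) mul0r.
Qed.

Lemma transfer_shift e0 w a r psi e : valid e0 w -> size e = size e0 ->
  transfer (shift w) psi (a :: e ++ r) = transfer w (fun m => psi (a :: m ++ r)) e.
Proof.
elim: w e0 e => // -[i g] w IH e0 e /andP[adm val] se.
rewrite -[shift _]/((i.+1, g) :: shift w) !transfer_cons.
have [pre [m [post [eE ipre sm]]]] : exists pre m post,
    [/\ e = pre ++ m ++ post, size pre = i & size m = nin g].
  by apply: local_split; case/andP: adm => H _; rewrite se.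
subst i; rewrite eE in se *; rewrite -[(size pre).+1]/(size (a :: pre)).
rewrite -!catA -cat_cons (weight_local (a :: pre) _ sm) (after_local (a :: pre) _ sm).
rewrite (weight_local pre _ sm) (after_local pre _ sm) !big_map.
congr (_ * _); apply: eq_big_seq => x xin.
have -> : (a :: pre) ++ x ++ post ++ r = a :: (pre ++ x ++ post) ++ r.
  by rewrite /= -!catA.
apply: (IH _ _ val); apply: (size_after_act adm se).
by rewrite (after_local pre _ sm); apply/mapP; exists x.
Qed.

End Transfer.

Local Close Scope ring_scope.

(** * Moves inside the disc *)
Section Explicit.

Variables (pre post : seq bool) (x y : bool) (o b : bool).

Lemma act_cup0 : act (pre ++ post) (size pre, Cup o) = pre ++ [:: o, ~~ o & post].
Proof. exact: (@act_local pre [::] post (Cup o) erefl). Qed.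

Lemma act_cap0 : act (pre ++ [:: x, y & post]) (size pre, Cap) = pre ++ post.
Proof. exact: (@act_local pre [:: x; y] post Cap erefl). Qed.

Lemma act_cross0 :
  act (pre ++ [:: x, y & post]) (size pre, Cross b) = pre ++ [:: y, x & post].
Proof. exact: (@act_local pre [:: x; y] post (Cross b) erefl). Qed.

Lemma negative_cross0 : negative (pre ++ [:: x, y & post]) (size pre, Cross b) = (b != (x == y)).
Proof. exact: (@negative_local pre [:: x; y] post (Cross b) erefl). Qed.

Lemma admissible_cap0 : admissible (pre ++ [:: x, y & post]) (size pre, Cap) = (x != y).
Proof. exact: (@admissible_local pre [:: x; y] post Cap erefl). Qed.

End Explicit.

Section Explicit1.

Variables (pre post : seq bool) (x y z : bool) (o b : bool).

Lemma act_cup1 : act (pre ++ x :: post) ((size pre).+1, Cup o) =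
  pre ++ [:: x, o, ~~ o & post].
Proof. by have := act_cup0 (rcons pre x) post o; rewrite !cat_rcons size_rcons. Qed.

Lemma act_cap1 : act (pre ++ [:: x, y, z & post]) ((size pre).+1, Cap) = pre ++ x :: post.
Proof. by have := act_cap0 (rcons pre x) post y z; rewrite !cat_rcons size_rcons. Qed.

Lemma act_cross1 : act (pre ++ [:: x, y, z & post]) ((size pre).+1, Cross b) =
  pre ++ [:: x, z, y & post].
Proof. by have := act_cross0 (rcons pre x) post y z b; rewrite !cat_rcons size_rcons. Qed.

Lemma negative_cross1 : negative (pre ++ [:: x, y, z & post]) ((size pre).+1, Cross b) =
  (b != (y == z)).
Proof. by have := negative_cross0 (rcons pre x) post y z b; rewrite !cat_rcons size_rcons. Qed.

Lemma admissible_cap1 : admissible (pre ++ [:: x, y, z & post]) ((size pre).+1, Cap) =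
  (y != z).
Proof. by have := admissible_cap0 (rcons pre x) post y z; rewrite !cat_rcons size_rcons. Qed.

End Explicit1.

Definition act_rules := (act_cup0, act_cap0, act_cross0, act_cup1, act_cap1, act_cross1).
Lemma negative_cup e i o : negative e (i, Cup o) = 0. Proof. by []. Qed.
Lemma negative_cap e i : negative e (i, Cap) = 0. Proof. by []. Qed.

Definition negative_rules := (negative_cross0, negative_cross1, negative_cup, negative_cap).
Definition admissible_rules := (admissible_cap0, admissible_cap1).

Local Open Scope ring_scope.

Section Steps.

Variables (R : comNzRingType) (q : R) (phi : seq bool -> R).

Lemma step_local pre m post g : size m = nin g ->
  step q (size pre, g) phi (pre ++ m ++ post) =
  q ^+ weight m (0%N, g) * \sum_(x <- after m (0%N, g)) phi (pre ++ x ++ post).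
Proof.
by move=> sm; rewrite /step (weight_local pre post sm) (after_local pre post sm) big_map.
Qed.

Lemma step_cup0 pre post o : step q (size pre, Cup o) phi (pre ++ post) =
  phi (pre ++ [:: true, true & post]) + phi (pre ++ [:: false, false & post]).
Proof.
by rewrite (@step_local pre [::] post (Cup o)) //= !big_cons big_nil /= mul1r addr0.
Qed.

Lemma step_cap0 pre x y post : step q (size pre, Cap) phi (pre ++ [:: x, y & post]) =
  if x == y then phi (pre ++ post) else 0.
Proof.
rewrite (@step_local pre [:: x; y] post Cap) //= mul1r.
by case: eqP => _; rewrite ?big_seq1 ?big_nil.
Qed.

Lemma step_cross0 pre x y post b :
  step q (size pre, Cross b) phi (pre ++ [:: x, y & post]) =
  q ^+ (b != (x != y)) * phi (pre ++ [:: ~~ y, ~~ x & post]).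
Proof. by rewrite (@step_local pre [:: x; y] post (Cross b)) //= big_seq1. Qed.

End Steps.

Section Steps1.

Variables (R : comNzRingType) (q : R) (phi : seq bool -> R).

Lemma step_cup1 pre x post o : step q ((size pre).+1, Cup o) phi (pre ++ x :: post) =
  phi (pre ++ [:: x, true, true & post]) + phi (pre ++ [:: x, false, false & post]).
Proof. by have := step_cup0 q phi (rcons pre x) post o; rewrite !cat_rcons size_rcons. Qed.

Lemma step_cap1 pre x y z post :
  step q ((size pre).+1, Cap) phi (pre ++ [:: x, y, z & post]) =
  if y == z then phi (pre ++ x :: post) else 0.
Proof. by have := step_cap0 q phi (rcons pre x) y z post; rewrite !cat_rcons size_rcons. Qed.

Lemma step_cross1 pre x y z post b :
  step q ((size pre).+1, Cross b) phi (pre ++ [:: x, y, z & post]) =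
  q ^+ (b != (y != z)) * phi (pre ++ [:: x, ~~ z, ~~ y & post]).
Proof.
by have := step_cross0 q phi (rcons pre x) y z post b; rewrite !cat_rcons size_rcons.
Qed.

End Steps1.

Definition step_rules := (step_cup0, step_cap0, step_cross0, step_cup1, step_cap1, step_cross1).

Lemma split1 (e : seq bool) i : (i < size e)%N ->
  exists pre x post, e = pre ++ x :: post /\ size pre = i.
Proof.
move=> lt; exists (take i e), (nth false e i), (drop i.+1 e).
by rewrite -drop_nth // cat_take_drop size_takel // ltnW.
Qed.

Lemma split2 (e : seq bool) i : (i.+1 < size e)%N ->
  exists pre x y post, e = pre ++ [:: x, y & post] /\ size pre = i.
Proof.
move=> lt; have [pre [x [[|y post] [E si]]]] := split1 (ltnW lt).
  by move: lt; rewrite E size_cat /= si addn1 ltnn.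
by exists pre, x, y, post.
Qed.

Lemma split3 (e : seq bool) i : (i.+2 < size e)%N ->
  exists pre x y z post, e = pre ++ [:: x, y, z & post] /\ size pre = i.
Proof.
move=> lt; have [pre [x [y [[|z post] [E si]]]]] := split2 (ltnW lt).
  by move: lt; rewrite E size_cat /= si addn2 ltnn.
by exists pre, x, y, z, post.
Qed.

Section Moves.

Variables (R : comNzRingType) (q : R).
Implicit Types (phi : seq bool -> R) (e : seq bool).

(** The power of q in [transfer] counts 1-resolutions. A move changes their number
    by as much as the number of negative crossings, whatever the colours;
    multiplying crosswise avoids negative powers of q. *)
Definition move_invariant u v : Prop := forall e0, valid e0 u -> valid e0 v ->
  foldl act e0 u = foldl act e0 v /\
  forall phi e, size e = size e0 ->
    q ^+ negatives e0 v * transfer q u phi e = q ^+ negatives e0 u * transfer q v phi e.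

(** The pieces act on disjoint strands, so the two sums may be exchanged. *)
Lemma exchange_invariant i k g1 g2 :
  move_invariant [:: (i, g1); ((i + nout g1 + k)%N, g2)]
                 [:: ((i + nin g1 + k)%N, g2); (i, g1)].
Proof.
have sizes (A : seq bool) g x : size A = nin g -> x \in after A (0%N, g) -> size x = nout g.
  move=> sA /size_after; rewrite add0n sA leqnn => /(_ isT); lia.
have acts (A : seq bool) g : size A = nin g -> size (act A (0%N, g)) = nout g.
  move=> sA; have := @size_act A 0 g; rewrite add0n sA leqnn => /(_ isT); lia.
have split (e : seq bool) : (i + nin g1 + k + nin g2 <= size e)%N ->
    exists pre A mid B post, [/\ e = pre ++ A ++ mid ++ B ++ post, size pre = i,
      size A = nin g1, size mid = k & size B = nin g2].
  move=> le; have [|pre [A [post1 [E sp sA]]]] := @local_split e i g1; first lia.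
  have [|mid [B [post [E1 sm sB]]]] := @local_split post1 k g2.
    by move: le; rewrite E !size_cat sp sA; lia.
  by exists pre, A, mid, B, post; rewrite E E1.
move=> e0 /andP[adm1 /andP[adm2 _]] _.
have le : (i + nin g1 + k + nin g2 <= size e0)%N.
  case/andP: adm1 => le1 _; case/andP: adm2 => le2 _.
  have := size_act le1; lia.
have [pre [A [mid [B [post [E0 sp sA sm sB]]]]]] := split _ le.
have posn (p x l : seq bool) n : size p = i -> size x = n -> size l = k ->
    (i + n + k)%N = size (p ++ x ++ l).
  by move=> sp' sx sl; rewrite !size_cat sp' sx sl addnA.
have cats (p x r l : seq bool) : p ++ x ++ r ++ l = (p ++ x ++ r) ++ l.
  by rewrite -!catA.
have pos1 := posn _ _ _ _ sp (acts _ _ sA) sm; have pos2 := posn _ _ _ _ sp sA sm.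
have E1 : act e0 (i, g1) = (pre ++ act A (0%N, g1) ++ mid) ++ B ++ post.
  by rewrite E0 -sp (act_local pre _ sA) cats.
have E2 : act e0 ((i + nin g1 + k)%N, g2) = pre ++ A ++ mid ++ act B (0%N, g2) ++ post.
  by rewrite E0 pos2 cats (act_local _ post sB) -cats.
have F1 : negative (act e0 (i, g1)) ((i + nout g1 + k)%N, g2) = negative B (0%N, g2).
  by rewrite E1 pos1 (negative_local _ post sB).
have F2 : negative (act e0 ((i + nin g1 + k)%N, g2)) (i, g1) = negative A (0%N, g1).
  by rewrite E2 -sp (negative_local pre _ sA).
have F3 : negative e0 (i, g1) = negative A (0%N, g1) by rewrite E0 -sp (negative_local pre _ sA).
have F4 : negative e0 ((i + nin g1 + k)%N, g2) = negative B (0%N, g2).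
  by rewrite E0 pos2 cats (negative_local _ post sB).
split.
  change (act (act e0 (i, g1)) ((i + nout g1 + k)%N, g2) =
          act (act e0 ((i + nin g1 + k)%N, g2)) (i, g1)).
  rewrite E1 E2 pos1 (act_local _ post sB) -sp (act_local pre _ sA).
  by rewrite -!catA.
move=> phi e se; rewrite -[negatives e0 [:: (i, g1); _]]/(negative e0 (i, g1) +
    (negative (act e0 (i, g1)) ((i + nout g1 + k)%N, g2) + 0))%N.
rewrite -[negatives e0 [:: _; (i, g1)]]/(negative e0 ((i + nin g1 + k)%N, g2) +
    (negative (act e0 ((i + nin g1 + k)%N, g2)) (i, g1) + 0))%N.
rewrite F1 F2 F3 F4 !addn0 addnC; congr (_ * _).
clear F1 F2 F3 F4 E1 E2 pos1 pos2 E0 sp sA sm sB; rewrite -se in le.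
have [p [A1 [l [B1 [r [-> sp sA sm sB]]]]]] := split _ le.
have pos2 := posn _ _ _ _ sp sA sm.
rewrite -[transfer _ [:: (i, g1); _] _]/(step q (i, g1) (step q ((i + nout g1 + k)%N, g2) phi)).
rewrite -[transfer _ [:: _; (i, g1)] _]/(step q ((i + nin g1 + k)%N, g2) (step q (i, g1) phi)).
rewrite -{1}sp step_local // pos2 cats step_local // -sp.
under eq_big_seq => x xA.
  rewrite sp cats (posn _ _ _ _ sp (sizes _ _ _ sA xA) sm) step_local //.
  over.
under [in RHS]eq_bigr => y _ do rewrite -cats step_local //.
rewrite -!mulr_sumr exchange_big mulrCA; congr (_ * (_ * _)).
by apply: eq_bigr => y _; apply: eq_bigr => x _; rewrite cats.
Qed.

Lemma negatives_cons e a w : negatives e (a :: w) = (negative e a + negatives (act e a) w)%N.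
Proof. by []. Qed.

Lemma negatives_nil e : negatives e [::] = 0%N.
Proof. by []. Qed.

Lemma valid_cons e a w : valid e (a :: w) = admissible e a && valid (act e a) w.
Proof. by []. Qed.

Lemma foldl_act_cons e a w : foldl act e (a :: w) = foldl act (act e a) w.
Proof. by []. Qed.

Lemma transfer_step a w phi e : transfer q (a :: w) phi e = step q a (transfer q w phi) e.
Proof. by []. Qed.

Lemma transfer_nil phi e : transfer q [::] phi e = phi e.
Proof. by []. Qed.

Lemma admissible_bound e i g : admissible e (i, g) -> (i + nin g <= size e)%N.
Proof. by case/andP. Qed.

(** Evaluates words at an explicit position of an explicitly split level. *)
Ltac run := rewrite ?(valid_cons, foldl_act_cons, negatives_cons, negatives_nil,
  transfer_step, transfer_nil, act_rules, admissible_rules, negative_rules, step_rules).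

Ltac finish := rewrite ?exprD /=; ring.

Lemma zigzagL_invariant i o : move_invariant [:: (i, Cup o); (i.+1, Cap)] [::].
Proof.
move=> e0 v0 _; have lt : (i < size e0)%N.
  case/andP: v0 => /admissible_bound; rewrite addn0 => le /andP[].
  by move/admissible_bound; have := @size_act e0 i (Cup o); rewrite addn0 => /(_ le) /=; lia.
have [pre [x [post [E0 sp]]]] := split1 lt; subst e0 i.
move: v0; run; move=> /and3P[_ ox _]; split; first by case: (o) ox; case: (x).
move=> phi e se; have [|p [y [r [-> <-]]]] := @split1 e (size pre); first by rewrite se.
by run; case: (y); finish.
Qed.

Lemma zigzagR_invariant i o : move_invariant [:: (i.+1, Cup o); (i, Cap)] [::].
Proof.
move=> e0 v0 _; have lt : (i < size e0)%N.
  by case/andP: v0 => /admissible_bound; rewrite addn0.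
have [pre [x [post [E0 sp]]]] := split1 lt; subst e0 i.
move: v0; run; move=> /and3P[_ ox _]; split; first by case: (o) ox; case: (x).
move=> phi e se; have [|p [y [r [-> <-]]]] := @split1 e (size pre); first by rewrite se.
by run; case: (y); finish.
Qed.

Lemma turn_cap_invariant i b :
  move_invariant [:: (i.+1, Cross b); (i, Cap)] [:: (i, Cross (~~ b)); (i.+1, Cap)].
Proof.
move=> e0 v0 _; have lt : (i.+2 < size e0)%N.
  by case/andP: v0 => /admissible_bound; rewrite addn2.
have [pre [x [y [z [post [E0 sp]]]]]] := split3 lt; subst e0 i.
move: v0; run; move=> /and3P[_ xz _]; split=> //.
move=> phi e se; have [|p [x' [y' [z' [r [-> <-]]]]]] := @split3 e (size pre); first by rewrite se.
run; case: (b); case: (x) xz; case: (y); case: (z) => // _;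
  by case: (x'); case: (y'); case: (z'); finish.
Qed.

Lemma turn_cup_invariant i o b :
  move_invariant [:: (i, Cup o); (i.+1, Cross b)] [:: (i.+1, Cup o); (i, Cross (~~ b))].
Proof.
move=> e0 _ v0; have lt : (i < size e0)%N.
  by case/andP: v0 => /admissible_bound; rewrite addn0.
have [pre [x [post [E0 sp]]]] := split1 lt; subst e0 i.
run; split=> //.
move=> phi e se; have [|p [y [r [-> <-]]]] := @split1 e (size pre); first by rewrite se.
by run; case: (b); case: (x); case: (o); case: (y); finish.
Qed.

Lemma R1r_invariant i o b :
  move_invariant [:: (i.+1, Cup o); (i, Cross b); (i.+1, Cap)] [::].
Proof.
move=> e0 v0 _; have lt : (i < size e0)%N.
  by case/andP: (v0) => /admissible_bound; rewrite addn0.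
have [pre [x [post [E0 sp]]]] := split1 lt; subst e0 i.
move: v0; run; move=> /and4P[_ _ xo _]; split; first by case: (o) xo; case: (x).
move=> phi e se; have [|p [y [r [-> <-]]]] := @split1 e (size pre); first by rewrite se.
by run; case: (b); case: (x) xo; case: (o) => // _; case: (y); finish.
Qed.

Lemma R1l_invariant i o b :
  move_invariant [:: (i, Cup o); (i.+1, Cross b); (i, Cap)] [::].
Proof.
move=> e0 v0 _; have lt : (i < size e0)%N.
  case/andP: v0 => /admissible_bound; rewrite addn0 => le /andP[].
  by move/admissible_bound; have := @size_act e0 i (Cup o); rewrite addn0 => /(_ le) /=; lia.
have [pre [x [post [E0 sp]]]] := split1 lt; subst e0 i.
move: v0; run; move=> /and4P[_ _ xo _]; split; first by case: (o) xo; case: (x).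
move=> phi e se; have [|p [y [r [-> <-]]]] := @split1 e (size pre); first by rewrite se.
by run; case: (b); case: (x) xo; case: (o) => // _; case: (y); finish.
Qed.

Lemma R2_invariant i b : move_invariant [:: (i, Cross b); (i, Cross (~~ b))] [::].
Proof.
move=> e0 v0 _; have lt : (i.+1 < size e0)%N.
  by case/andP: v0 => /admissible_bound; rewrite addn2.
have [pre [x [y [post [E0 sp]]]]] := split2 lt; subst e0 i.
run; split=> //.
move=> phi e se; have [|p [x' [y' [r [-> <-]]]]] := @split2 e (size pre); first by rewrite se.
by run; case: (b); case: (x); case: (y); case: (x'); case: (y'); finish.
Qed.

Lemma R3_invariant i a b c : move_invariant
  [:: (i, Cross a); (i.+1, Cross b); (i, Cross c)]
  [:: (i.+1, Cross c); (i, Cross b); (i.+1, Cross a)].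
Proof.
move=> e0 _ v0; have lt : (i.+2 < size e0)%N.
  by case/andP: v0 => /admissible_bound; rewrite addn2.
have [pre [x [y [z [post [E0 sp]]]]]] := split3 lt; subst e0 i.
run; split=> //.
move=> phi e se; have [|p [x' [y' [z' [r [-> <-]]]]]] := @split3 e (size pre); first by rewrite se.
have negN u v : (~~ u != ~~ v) = (u != v) by case: u; case: v.
have negNl u v : (~~ u != v) = (u != ~~ v) by case: u; case: v.
run; rewrite !addn0 !negN negNl; congr (_ * _).
  by congr (_ ^+ _); rewrite [RHS]addnC [RHS]addnAC [RHS]addnC.
move: (q ^+ (a != _)) (q ^+ (b != _)) (q ^+ (c != _)) (phi _) => A B C P; ring.
Qed.

Lemma local_move_invariant u v : local_move u v -> move_invariant u v.
Proof.
case=> *; [exact: exchange_invariant|exact: zigzagL_invariant|exact: zigzagR_invariant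
  |exact: turn_cap_invariant|exact: turn_cup_invariant|exact: R1r_invariant
  |exact: R1l_invariant|exact: R2_invariant|exact: R3_invariant].
Qed.

End Moves.

(** * Moves across the boundary circle *)
Lemma foldl_act_shift e w a r : valid e w ->
  foldl act (a :: e ++ r) (shift w) = a :: foldl act e w ++ r /\
  negatives (a :: e ++ r) (shift w) = negatives e w.
Proof.
elim: w e => // -[i g] w IH e /andP[adm val].
rewrite -[shift _]/((i.+1, g) :: shift w) !foldl_act_cons !negatives_cons.
have [pre [m [post [E sp sm]]]] := local_split (admissible_bound adm).
have cats : (pre ++ m ++ post) ++ r = pre ++ m ++ (post ++ r) by rewrite -!catA.
have E1 : act (a :: e ++ r) (i.+1, g) = a :: act e (i, g) ++ r.
  subst e i; rewrite cats -[(size pre).+1]/(size (a :: pre)) -cat_cons.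
  by rewrite (act_local (a :: pre) _ sm) (act_local pre _ sm) /= -!catA.
have E2 : negative (a :: e ++ r) (i.+1, g) = negative e (i, g).
  subst e i; rewrite cats -[(size pre).+1]/(size (a :: pre)) -cat_cons.
  by rewrite (negative_local (a :: pre) _ sm) (negative_local pre _ sm).
by have [H1 H2] := IH _ val; rewrite E1 E2 H1 H2.
Qed.

Lemma rev_cat3 (a b c : seq bool) : rev (a ++ b ++ c) = rev c ++ rev b ++ rev a.
Proof. by rewrite !rev_cat catA. Qed.

Section Reflection.

Variables (m : seq bool) (i : nat) (g : piece).
Hypothesis bound : (i + nin g <= size m)%N.

Let j := (size m - nin g - i)%N.

Let split : exists pre mid post, [/\ m = pre ++ mid ++ post, size pre = i,
  size mid = nin g & size (rev post) = j].
Proof.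
have [pre [mid [post [E sp sm]]]] := local_split bound.
exists pre, mid, post; split=> //; rewrite size_rev /j E !size_cat sp sm; lia.
Qed.

Lemma nin_reflect : nin (reflect_piece g) = nin g. Proof. by case: g. Qed.
Lemma act_reflect : act (rev m) (j, reflect_piece g) = rev (act m (i, g)).
Proof.
have [pre [mid [post [-> <- sm <-]]]] := split.
have sm' : size (rev mid) = nin (reflect_piece g) by rewrite size_rev sm nin_reflect.
rewrite rev_cat3 (act_local _ _ sm') (act_local _ _ sm) rev_cat3.
congr (_ ++ _ ++ _); case: g sm => [o||b] /=.
- by move/size0nil => ->; rewrite /= negbK.
- by case: mid {sm'} => [|x [|y [|]]].
- by case: mid {sm'} => [|x [|y [|]]].
Qed.

Lemma negative_reflect : negative (rev m) (j, reflect_piece g) = negative m (i, g).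
Proof.
have [pre [mid [post [-> <- sm <-]]]] := split.
have sm' : size (rev mid) = nin (reflect_piece g) by rewrite size_rev sm nin_reflect.
rewrite rev_cat3 (negative_local _ _ sm') (negative_local _ _ sm).
case: g sm => [o||b] //=.
by case: mid {sm'} => [|x [|y [|]]] //= _; rewrite /negative /= [y == x]eq_sym.
Qed.

Lemma step_reflect (R : comNzRingType) (q : R) psi :
  step q (j, reflect_piece g) psi (rev m) = step q (i, g) (fun e => psi (rev e)) m.
Proof.
have [pre [mid [post [-> <- sm <-]]]] := split.
have sm' : size (rev mid) = nin (reflect_piece g) by rewrite size_rev sm nin_reflect.
rewrite rev_cat3 (step_local _ _ _ _ sm') (step_local _ _ _ _ sm).
case: g sm => [o||b] /=.
- by move/size0nil => ->; rewrite /= !big_cons !big_nil /= !(rev_cat, rev_cons, cat_rcons).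
- case: mid {sm'} => [|x [|y [|]]] //= _; rewrite [y == x]eq_sym.
  by case: ifP; rewrite ?big_nil // !big_seq1 /= !(rev_cat, rev_cons, cat_rcons).
- case: mid {sm'} => [|x [|y [|]]] //= _; rewrite !big_seq1 /= !(rev_cat, rev_cons, cat_rcons).
  by rewrite /weight /= [y == x]eq_sym.
Qed.

End Reflection.

Section Partition.

Variables (R : comNzRingType) (q : R).

(** The trace of the transfer operator, with a reversal because the top level is
    glued to the bottom level by the antipodal map. *)
Definition state_sum (D : diagram) : R :=
  level_sum (size (bot D)) (fun e => transfer q (word D) (delta R (rev e)) e).

Definition writhe_minus (D : diagram) : nat := negatives (bot D) (word D).

Definition state_sums_agree (D D' : diagram) : Prop :=
  q ^+ writhe_minus D' * state_sum D = q ^+ writhe_minus D * state_sum D'.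

Lemma diagram_valid D : valid (bot D) (word D).
Proof. by case/andP: (diagramP D). Qed.

Lemma level_sumZ n c (F : seq bool -> R) :
  c * level_sum n F = level_sum n (fun e => c * F e).
Proof. exact: mulr_sumr. Qed.

Lemma in_disc_agree (D D' : diagram) w1 u v w2 : local_move u v ->
  bot D' = bot D -> word D = w1 ++ u ++ w2 -> word D' = w1 ++ v ++ w2 ->
  state_sums_agree D D'.
Proof.
move=> uv bE wE wE'; have := diagram_valid D; have := diagram_valid D'.
rewrite /state_sums_agree /state_sum /writhe_minus bE wE wE'.
move: (bot D) => e0; rewrite !valid_cat => /and3P[v1 vv _] /and3P[_ vu v2].
have [fE tE] := local_move_invariant q uv vu vv.
rewrite !level_sumZ; apply: eq_level_sum => e se; rewrite !negatives_cat -fE.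
set n1 := negatives e0 w1; set n2 := negatives _ w2; set e1 := foldl act e0 w1 in tE *.
rewrite !transfer_cat; set psi := transfer q w2 _.
have H : transfer q w1 (fun x => q ^+ negatives e1 v * transfer q u psi x) e =
         transfer q w1 (fun x => q ^+ negatives e1 u * transfer q v psi x) e.
  by apply: transfer_ext v1 _ _ se => x sx; exact: tE.
move: H; rewrite !transferZ => H.
by rewrite !exprD -!mulrA ![q ^+ n2 * _]mulrC !mulrA -!(mulrA (q ^+ n1)) H.
Qed.

(** The new cup joins the former bottom left end to the new top left one, and the
    new cap joins the former top right end to the new bottom right one, so the
    closing condition of the rotated diagram becomes that of the original. *)
Lemma rotate_agree (D D' : diagram) o e : bot D = o :: e -> bot D' = rcons e (~~ o) ->
  word D' = (0%N, Cup (~~ o)) :: shift (word D) ++ [:: ((size e).+1, Cap)] ->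
  state_sums_agree D D'.
Proof.
move=> bE bE' wE; have val := diagram_valid D.
have szf : size (foldl act (bot D) (word D)) = (size e).+1.
  by case/andP: (diagramP D) => _ /eqP ->; rewrite size_rev bE.
have negE : writhe_minus D' = writhe_minus D.
  rewrite /writhe_minus wE bE' negatives_cons negative_cup add0n negatives_cat.
  rewrite (act_cup0 [::]) /= negbK -cats1 -[_ :: _ :: _]/(~~ o :: (o :: e) ++ [:: ~~ o]) -bE.
  have [_ ->] := foldl_act_shift (~~ o) [:: ~~ o] val; rewrite negative_cap; lia.
rewrite /state_sums_agree negE; congr (_ * _).
rewrite /state_sum bE bE' size_rcons [LHS]level_sum_cons [RHS]level_sum_rcons.
pose w := word D; pose cap : slice := ((size e).+1, Cap).
pose G a z y := transfer q (shift w) (step q cap (delta R (z :: rev y))) (a :: (a :: y) ++ [:: z]).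
transitivity (\sum_(a : bool) \sum_(z : bool) level_sum (size e) (G a z)); last first.
  rewrite /level_sum [LHS]exchange_big; apply: eq_bigr => z _.
  rewrite [LHS]exchange_big; apply: eq_bigr => y _; rewrite wE transfer_step transfer_cat.
  rewrite -[(0%N, _)]/(size (Nil bool), Cup (~~ o)) (step_cup0 _ _ [::]) rev_rcons -cats1.
  by rewrite big_bool.
apply: eq_bigr => a _; rewrite /level_sum [RHS]exchange_big; apply: eq_bigr => y _.
have sy : size y = size e by rewrite size_tuple.
have sye : size (a :: y) = size (bot D) by rewrite bE /= sy.
under [RHS]eq_bigr => z _ do rewrite /G (transfer_shift _ _ _ _ val sye).
pose F (z : bool) m := step q cap (delta R (z :: rev y)) (a :: m ++ [:: z]).
transitivity (transfer q w (fun m => \sum_z F z m * 1) (a :: y)); last first.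
  by rewrite transfer_sum; apply: eq_bigr => z _; rewrite mulr1.
apply: transfer_ext val _ _ sye => m; rewrite szf.
case/lastP: m => [//|m l]; rewrite size_rcons => -[sm].
have FE z : F z (rcons m l) = if l == z then ((a == z) && (m == rev y))%:R else 0.
  rewrite /F -cats1 -catA -cat_cons /cap -sm -[(size m).+1]/(size (a :: m)) step_cap0.
  by rewrite cats0 /delta eqseq_cons.
rewrite big_bool !FE !mulr1 /delta rev_cons eqseq_rcons.
by case: a {G F FE}; case: l; rewrite /= ?addr0 ?add0r ?andbF ?andbT.
Qed.

(** Moving the last factor of a product of operators to the front does not
    change the trace. The reversal of levels in the trace matches the
    reflection of the piece. *)
Lemma across_boundary_agree (D D' : diagram) w i g : word D = w ++ [:: (i, g)] ->
  bot D' = rev (foldl act (bot D) w) ->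
  word D' = ((size (bot D) - nout g - i)%N, reflect_piece g) :: w ->
  state_sums_agree D D'.
Proof.
move=> wE bE wE'; have := diagram_valid D; rewrite wE valid_cat => /andP[val /andP[adm _]].
set m0 := foldl act (bot D) w in adm bE.
have bd := admissible_bound adm.
have last : act m0 (i, g) = rev (bot D).
  by case/andP: (diagramP D) => _ /eqP <-; rewrite wE foldl_cat.
have szE : (size (bot D) - nout g - i)%N = (size m0 - nin g - i)%N.
  by have := size_act bd; rewrite last size_rev; lia.
have negE : writhe_minus D' = writhe_minus D.
  rewrite /writhe_minus wE wE' bE szE negatives_cons negative_reflect // act_reflect //.
  by rewrite last revK negatives_cat negatives_cons addn0 addnC.
rewrite /state_sums_agree negE; congr (_ * _).
rewrite /state_sum wE wE' bE szE size_rev.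
have lastval : valid m0 [:: (i, g)] by rewrite valid_cons adm.
have lastsz : size (foldl act m0 [:: (i, g)]) = size (bot D).
  by rewrite -[foldl _ _ _]/(act m0 (i, g)) last size_rev.
transitivity (level_sum (size m0) (fun m => level_sum (size (bot D)) (fun e =>
    transfer q w (delta R m) e * step q (i, g) (delta R (rev e)) m))).
  rewrite [RHS]exchange_big; apply: eq_bigr => e _.
  by rewrite transfer_cat (transfer_expand q _ val) ?size_tuple.
rewrite [RHS]level_sum_rev; apply: eq_bigr => m _; rewrite transfer_step revK.
rewrite (_ : (size m0 - nin g - i)%N = (size m - nin g - i)%N); last by rewrite size_tuple.
rewrite step_reflect ?size_tuple //.
have := @transfer_expand R q m0 [:: (i, g)] (fun e => transfer q w (delta R m) (rev e)) m lastval.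
rewrite size_tuple lastsz => /(_ erefl) E; apply: etrans (esym E).
rewrite [RHS]level_sum_rev.
by apply: eq_bigr => e _; rewrite revK mulrC.
Qed.

Lemma move_agree D D' : move D D' -> state_sums_agree D D'.
Proof.
by case=> *; [apply: in_disc_agree; eassumption|apply: rotate_agree; eassumption
  |apply: across_boundary_agree; eassumption].
Qed.

End Partition.

(** * Counting proper colourings *)

(** The sequences of levels that the colours can run through. *)
Fixpoint histories (w : seq slice) (e : seq bool) : seq (seq (seq bool)) :=
  if w is a :: w' then [seq e :: h | e' <- after e a, h <- histories w' e']
  else [:: [:: e]].

Fixpoint total_weight (w : seq slice) (h : seq (seq bool)) : nat :=
  if w is a :: w' then (weight (head [::] h) a + total_weight w' (behead h))%N else 0%N.

Lemma mem_histories w e h : h \in histories w e <->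
  [/\ size h = (size w).+1, nth [::] h 0 = e &
     forall t, (t < size w)%N ->
       nth [::] h t.+1 \in after (nth [::] h t) (nth (0%N, Cap) w t)].
Proof.
elim: w e h => [|a w IH] e h.
  rewrite inE; split=> [/eqP -> //|[]].
  by case: h => [|e' [|]] //= _ ->.
split=> [/allpairsPdep[e' [h' [e'a /IH[sh h0 ht] ->]]]|[sh h0 ht]].
  by split=> //= [|[|t] lt //=]; [rewrite sh|rewrite h0|exact: ht].
case: h sh h0 ht => [//|e1 h] [sh] /= <- ht.
apply/allpairsPdep; exists (nth [::] h 0), h; split=> //.
  exact: (ht 0%N).
by apply/IH; split=> // t lt; exact: (ht t.+1).
Qed.

Lemma uniq_after e a : uniq (after e a).
Proof.
case: a => i [o||b] //=; last by case: ifP.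
by rewrite inE andbT eqseq_cat // eqxx.
Qed.

Lemma uniq_histories w e : uniq (histories w e).
Proof.
elim: w e => // a w IH e; apply: allpairs_uniq_dep => [|e' _|]; [exact: uniq_after|exact: IH|].
move=> [e1 h1] [e2 h2] /allpairsPdep[x [y [xa yh [-> ->]]]].
move=> /allpairsPdep[x' [y' [xa' yh' [-> ->]]]] /= [E]; subst y'.
move/mem_histories: yh => [_ <- _]; move/mem_histories: yh' => [_ <- _].
by [].
Qed.

Lemma transfer_histories (R : comNzRingType) (q : R) w phi e :
  transfer q w phi e =
  \sum_(h <- histories w e) q ^+ total_weight w h * phi (last [::] h).
Proof.
elim: w e => [|a w IH] e; first by rewrite big_seq1 mul1r.
rewrite transfer_step /step /histories -/histories big_allpairs_dep mulr_sumr.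
apply: eq_bigr => e' _; rewrite IH mulr_sumr; apply: eq_big_seq => h /mem_histories[sh _ _].
by rewrite /= exprD mulrA; case: h sh.
Qed.

Lemma total_weight_sum w h : size h = (size w).+1 ->
  total_weight w h = (\sum_(t < size w) weight (nth [::] h t) (nth (0, Cap) w t))%N.
Proof.
elim: w h => [|a w IH] [|e h] //= [sh]; first by rewrite big_ord0.
by rewrite big_ord_recl /= IH.
Qed.

Lemma negatives_sum e w :
  negatives e w = (\sum_(t < size w) negative (foldl act e (take t w)) (nth (0, Cap) w t))%N.
Proof.
elim: w e => [|a w IH] e; first by rewrite big_ord0.
by rewrite negatives_cons IH big_ord_recl.
Qed.

Section Counting.

Variable D : diagram.
Notation m := (size (word D)).

Lemma slice_nth t : nth (0%N, Cap) (word D) t = (pos D t, pc D t).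
Proof. by rewrite /pos /pc; case: nth. Qed.

Lemma sum_crossings (F : nat -> nat) :
  (\sum_(c : crossing D) F (ht c) = \sum_(t < m | is_cross (pc D t)) F t)%N.
Proof.
rewrite -(big_imset (fun t : 'I_m => F t) (h := fun c : crossing D => val c) (A := predT)) /=.
  apply: eq_bigl => t; apply/imsetP/idP => [[c _ ->]|ct]; first exact: (valP c).
  by exists (exist _ t ct).
by move=> c c' _ _ /val_inj.
Qed.

Lemma n_minusE : n_minus D = writhe_minus D.
Proof.
rewrite /writhe_minus negatives_sum /n_minus -sum1dep_card big_mkcond /=.
pose F t := negative (level D t) (pos D t, pc D t).
transitivity (\sum_(c : crossing D) F (ht c))%N.
  apply: eq_bigr => c _; rewrite /F /negative pc_ht /positive /=.
  by case: eqP.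
rewrite sum_crossings big_mkcond /=; apply: eq_bigr => t _; rewrite slice_nth /F.
by case: ifP => // nc; rewrite /negative /=; case: (pc D t) nc.
Qed.

Definition history (f : point D -> bool) : seq (seq bool) := mkseq (colours f) m.+1.

Lemma nth_history f t : (t <= m)%N -> nth [::] (history f) t = colours f t.
Proof. by move=> le; rewrite nth_mkseq. Qed.

Lemma mem_after i g A B :
    (i + nin g <= size A)%N -> (size B + nin g = size A + nout g)%N ->
  (B \in after A (i, g)) = flows i g A B &&
    (if g is Cross _ then (nth false B i == ~~ nth false A i.+1)
                          && (nth false B i.+1 == ~~ nth false A i) else true).
Proof.
move=> bA sB.
have st : (i <= size B)%N -> size (take i B) = size (take i A).
  by move=> le; rewrite !size_takel //; apply: leq_trans bA; exact: leq_addr.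
have BE x y : (i + 2 <= size B)%N -> (B == take i A ++ [:: x, y & drop (i + nin g) A]) =
    [&& take i A == take i B, drop (i + nin g) A == drop (i + 2) B,
        nth false B i == x & nth false B i.+1 == y].
  move=> b2; rewrite {1}(split_two b2) eqseq_cat; last by apply: st; lia.
  rewrite /= !eqseq_cons eq_sym; congr (_ && _).
  by rewrite [drop _ B == _]eq_sym andbA andbC.
rewrite /after /flows; case: g bA sB BE => [o||b] /= bA sB BE.
- by rewrite !inE !BE; lia.
- rewrite addn0 in sB; rewrite addn0.
  have BC : (B == take i A ++ drop (i + 2) A) =
      (take i A == take i B) && (drop (i + 2) A == drop i B).
    rewrite -{1}(cat_take_drop i B) eqseq_cat; last by apply: st; rewrite -(leq_add2r 2) sB.
    by rewrite eq_sym [drop i B == _]eq_sym.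
  by case: ifP => _; rewrite ?inE ?BC !andbT ?andbF.
- by rewrite inE BE ?andbT; [rewrite !andbA|lia].
Qed.

(** The colourings that are proper for some smoothing. *)
Definition traversable (f : point D -> bool) : bool :=
  tangle_colouring f &&
  [forall c, (f (corner_of c true false) == ~~ f (corner_of c false true))
          && (f (corner_of c true true) == ~~ f (corner_of c false false))].

Lemma traversable_history f : traversable f <->
  (forall t, (t < m)%N ->
     colours f t.+1 \in after (colours f t) (nth (0%N, Cap) (word D) t)) /\
  colours f m = rev (colours f 0).
Proof.
have memE t : (t < m)%N -> (colours f t.+1 \in after (colours f t) (nth (0%N, Cap) (word D) t)) =
    flows (pos D t) (pc D t) (colours f t) (colours f t.+1) &&
    (if pc D t is Cross _ then
       (nth false (colours f t.+1) (pos D t) == ~~ nth false (colours f t) (pos D t).+1)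
       && (nth false (colours f t.+1) (pos D t).+1 == ~~ nth false (colours f t) (pos D t))
     else true).
  move=> lt; rewrite slice_nth mem_after // !size_colours.
    exact: pos_bound.
  exact: size_level_succ.
have crE c : (nth false (colours f (ht c).+1) (pos D (ht c)) ==
      ~~ nth false (colours f (ht c)) (pos D (ht c)).+1) &&
     (nth false (colours f (ht c).+1) (pos D (ht c)).+1 ==
      ~~ nth false (colours f (ht c)) (pos D (ht c))) =
    (f (corner_of c true false) == ~~ f (corner_of c false true))
          && (f (corner_of c true true) == ~~ f (corner_of c false false)).
  by rewrite -!nth_corner.
split=> [/andP[/tangle_colouring_levels[fl cl] /forallP cr]|[H cl]].
  split=> // t lt; rewrite memE // fl //=; case E: (pc D t) => [||b] //.
  by have [c <- _] := crossing_at lt E; rewrite crE.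
apply/andP; split.
  by apply/tangle_colouring_levels; split=> // t lt; have := H t lt; rewrite memE // => /andP[].
apply/forallP => c; have := H _ (ht_lt c); rewrite memE ?ht_lt // pc_ht => /andP[_].
by rewrite crE.
Qed.

Lemma history_surj h e : size e = size (bot D) -> h \in histories (word D) e ->
    last [::] h = rev e ->
  exists2 f : {ffun point D -> bool}, traversable f & history f = h.
Proof.
move=> se /mem_histories[sh h0 ht] lh.
have sz t : (t <= m)%N -> size (nth [::] h t) = size (level D t).
  elim: t => [|t IH] lt; first by rewrite h0 se /level take0.
  have := ht t lt; rewrite slice_nth => /size_after; rewrite IH ?(ltnW lt) //.
  move=> /(_ (pos_bound lt)); have := size_level_succ lt; lia.
pose v t j := nth false (nth [::] h t) j.
pose f := [ffun p : point D => v (tag p) (tagged p)].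
have fE t : (t <= m)%N -> colours f t = nth [::] h t.
  move=> le; apply: (@eq_from_nth _ false); rewrite size_colours ?sz // => j lj.
  have [p pt] := point_at le lj; rewrite (nth_colours f pt) ffunE.
  by case/andP: pt => /eqP E1 /eqP E2; rewrite -/(v t j); congr v.
exists f.
  apply/traversable_history; split=> [t lt|]; first by rewrite !fE ?(ltnW lt) //; exact: ht.
  by rewrite !fE // h0 -lh -nth_last sh.
apply: (@eq_from_nth _ [::]); first by rewrite size_mkseq sh.
by rewrite size_mkseq => t lt; rewrite nth_history // fE.
Qed.

Lemma history_inj : injective (fun f : {ffun point D -> bool} => history f).
Proof.
move=> f f' E; apply/ffunP; apply: colours_inj => t le.
by rewrite -!nth_history // E.
Qed.

Definition colour_weight (f : point D -> bool) : nat :=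
  (\sum_(t < m) weight (colours f t) (nth (0, Cap) (word D) t))%N.

Lemma state_sum_colourings (R : comNzRingType) (q : R) :
  state_sum q D =
  \sum_(f : {ffun point D -> bool} | traversable f) q ^+ colour_weight f.
Proof.
pose good (h : seq (seq bool)) := last [::] h == rev (head [::] h).
pose H := [seq h <- [seq h | e <- enum {: (size (bot D)).-tuple bool},
                             h <- histories (word D) (val e)] | good h].
transitivity (\sum_(h <- H) q ^+ total_weight (word D) h).
  rewrite big_filter big_mkcond big_allpairs_dep /state_sum /level_sum.
  rewrite big_enum /=; apply: eq_bigr => e _; rewrite transfer_histories.
  apply: eq_big_seq => h /mem_histories[_ h0 _].
  by rewrite /delta /good -nth0 h0; case: eqP => _; rewrite ?mulr1 ?mulr0.
pose T := fun f : {ffun point D -> bool} => traversable f.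
have HE : perm_eq H [seq history f | f : {ffun point D -> bool} <- enum T].
  apply: uniq_perm.
  - apply: filter_uniq; apply: allpairs_uniq_dep => [|e _|]; first exact: enum_uniq.
      exact: uniq_histories.
    move=> [e1 h1] [e2 h2] /allpairsPdep[x [y [_ yh [-> ->]]]].
    move=> /allpairsPdep[x' [y' [_ yh' [-> ->]]]] /= E; subst y'.
    move/mem_histories: yh => [_ E1 _]; move/mem_histories: yh' => [_ E2 _].
    by have -> : x = x' by apply: val_inj; rewrite -E1 -E2.
  - rewrite map_inj_uniq ?enum_uniq //; exact: history_inj.
  move=> h; rewrite mem_filter; apply/andP/mapP => [[gh /allpairsPdep[e [h' [_ hh' hE]]]]|[f]].
    subst h'; have /mem_histories[_ h0 _] := hh'.
    have [||f tf <-] := @history_surj h e _ hh'; first by rewrite size_tuple.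
      by apply/eqP; rewrite -h0 nth0.
    by exists f; rewrite ?mem_enum.
  rewrite mem_enum => /traversable_history[st cl] ->.
  have h0 : head [::] (history f) = colours f 0 by rewrite -nth0 nth_history.
  have sc : size (colours f 0) == size (bot D) by rewrite size_colours /level take0.
  split; first by rewrite /good h0 -cl -nth_last size_mkseq nth_history.
  apply/allpairsPdep; exists (Tuple sc), (history f); split; rewrite ?mem_enum //.
  apply/mem_histories; split; [by rewrite size_mkseq|by rewrite nth_history|].
  by move=> t lt; rewrite !nth_history ?(ltnW lt) //; exact: st.
rewrite (perm_big _ HE) big_map big_enum /=; apply: eq_bigr => f _; congr (_ ^+ _).
rewrite total_weight_sum ?size_mkseq //; apply: eq_bigr => t _.
by rewrite nth_history // ltnW.
Qed.

(** The only smoothing for which a traversable colouring is constant on circles: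
    the arcs are vertical iff the colours below the crossing differ. *)
Definition forced_smoothing (f : point D -> bool) : smoothing D :=
  [ffun c => sw_over c != (f (corner_of c false false) != f (corner_of c false true))].

Lemma compatible_not_mono (f : point D -> bool) (c : crossing D) (v : bool) :
  compatible f c v && ~~ mono f c =
  [&& v == (f (corner_of c false false) != f (corner_of c false true)),
      f (corner_of c true false) == ~~ f (corner_of c false true)
    & f (corner_of c true true) == ~~ f (corner_of c false false)].
Proof.
rewrite /mono /compatible; case: v; case: (f _); case: (f _); case: (f _); by case: (f _).
Qed.

Lemma proper_traversable (x : enhanced D) : constant_on_circles x && proper x =
  traversable (lab x) && (sm x == forced_smoothing (lab x)).
Proof.
have E c : compatible (lab x) c (vertical (sm x) c) && ~~ mono (lab x) c =
   (sm x c == forced_smoothing (lab x) c) &&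
   ((lab x (corner_of c true false) == ~~ lab x (corner_of c false true))
          && (lab x (corner_of c true true) == ~~ lab x (corner_of c false false))).
  have solve_for (a b v : bool) : ((a != b) == v) = (b == (a != v)) by case: a b v => [] [] [].
  by rewrite compatible_not_mono /forced_smoothing ffunE /vertical solve_for.
rewrite constant_on_circlesE /proper /traversable -!andbA; congr (_ && _).
apply/andP/andP => [[/forallP H1 /forallP H2]|[/forallP H1 /eqP H2]].
  have H c := E c; split.
    by apply/forallP => c; have := E c; rewrite H1 H2 => /esym/andP[].
  by apply/eqP/ffunP => c; have := E c; rewrite H1 H2 => /esym/andP[/eqP].
by split; apply/forallP => c; have := E c; rewrite H1 H2 eqxx => /andP[].
Qed.

Lemma ones_forced f : ones (forced_smoothing f) = colour_weight f.
Proof.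
rewrite /ones -sum1dep_card big_mkcond /= /colour_weight.
pose F t := weight (colours f t) (pos D t, pc D t).
transitivity (\sum_(c : crossing D) F (ht c))%N.
  apply: eq_bigr => c _; rewrite /F /weight pc_ht /= ffunE.
  by rewrite -(nth_corner f c false false) -(nth_corner f c false true); case: (_ != _).
rewrite sum_crossings big_mkcond /=; apply: eq_bigr => t _; rewrite slice_nth /F.
by case: ifP => // nc; rewrite /weight /=; case: (pc D t) nc.
Qed.

(** The factor 2 is the choice of a superscript. *)
Lemma sum_proper (R : comNzRingType) (q : R) :
  \sum_(x : enhanced D | constant_on_circles x && proper x) q ^+ ones (sm x) =
  2 * state_sum q D.
Proof.
rewrite state_sum_colourings.
pose lift (p : bool * {ffun point D -> bool}) : enhanced D := (forced_smoothing p.2, p.2, p.1).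
rewrite (reindex_onto lift (fun x => (x.2, x.1.2))) /=; last first.
  move=> x; rewrite proper_traversable => /andP[_ /eqP sx].
  by case: x sx => [[s l] u]; rewrite /sm /lab /lift /= => ->.
rewrite (eq_bigl (fun p : bool * {ffun point D -> bool} => true && traversable p.2)); last first.
  by move=> [u f]; rewrite proper_traversable /sm /lab /= !eqxx !andbT.
rewrite -(pair_big predT (fun f : {ffun point D -> bool} => traversable f)
  (fun _ f => q ^+ ones (forced_smoothing f))) /=.
rewrite big_bool /= mulr_natl mulr2n; congr (_ + _);
  by apply: eq_bigr => f _; rewrite ones_forced.
Qed.

End Counting.

(** Degrees are compared as coefficients of polynomials in q = X. Shifting the
    index by both numbers of negative crossings keeps it a natural number
    whenever one of the two sides can be nonzero. *)
Lemma proper_at_agree (D D' : diagram) :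
    (forall (R : comNzRingType) (q : R), state_sums_agree q D D') ->
  forall i, #|proper_at D i| = #|proper_at D' i|.
Proof.
move=> agree i.
have coefE (E E' : diagram) (k : nat) : i + (n_minus E)%:Z + (n_minus E')%:Z = k%:Z ->
    ('X^(writhe_minus E') * (2 * state_sum 'X E) : {poly int})`_k = #|proper_at E i|%:R.
  move=> kE; rewrite -sum_proper mulr_sumr coef_sum.
  under eq_bigr => x _ do rewrite -exprD coefXn.
  rewrite -natr_sum; congr _%:R; rewrite -sum1_card big_mkcond [RHS]big_mkcond /=.
  apply: eq_bigr => x _; rewrite inE andbA.
  have -> : (height (sm x) == i) = (k == writhe_minus E' + ones (sm x))%N.
    by rewrite /height -/(ones _) -!n_minusE; apply/eqP/eqP; lia.
  by case: (_ && _) => //=; case: (_ == _).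
have [[k kE]|neg] : (exists k : nat, i + (n_minus D)%:Z + (n_minus D')%:Z = k%:Z) \/
    i + (n_minus D)%:Z + (n_minus D')%:Z < 0.
  case: (i + _ + _)%R => [k|k]; [by left; exists k|by right].
  have := congr1 (fun p : {poly int} => (2 * p)`_k) (agree {poly int} 'X).
  have kE' : i + (n_minus D')%:Z + (n_minus D)%:Z = k%:Z by rewrite addrAC.
  by rewrite !(mulrCA 2) (coefE D D') // (coefE D' D) // !natz => -[].
have none (E : diagram) : i + (n_minus E)%:Z < 0 -> #|proper_at E i| = 0%N.
  move=> lt; apply: eq_card0 => x; rewrite inE /height; apply/negbTE.
  by rewrite !negb_and; apply/or3P/Or33; apply/eqP; lia.
by rewrite !none //; lia.
Qed.

Local Close Scope ring_scope.

Lemma same_link_proper_at (D D' : diagram) : same_link D D' ->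
  forall i, #|proper_at D i| = #|proper_at D' i|.
Proof.
elim=> [E E' mv|E|E E' _ IH|E E' E'' _ IH _ IH'] i //; last by rewrite IH.
by apply: proper_at_agree => R q; exact: move_agree mv.
Qed.

Theorem theorem5p2 (D : diagram) :
  is_complex (CDBN D) /\
  forall D' : diagram, same_link D D' ->
    homotopy_equivalent (CDBN D) (CDBN D').
Proof.
split=> [|D' DD']; first exact: CDBN_is_complex.
exact/CDBN_homotopy_equivalent/same_link_proper_at.
Qed.
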